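(* Let $k\ge 1$, $\delta\in\mathbb{C}\setminus\{0\}$, let $\mu$ be a composition of $m\le k$, and let $\lambda\vdash j\le m$. Put $Y=[k]\setminus[m]$. Then $$\chi_{\mathcal{P}_k^\lambda}(d_\mu)=\sum_{X\subset[m]}\ \sum_{\xi\in\mathcal{SP}_X^\mu}\chi_{\mathcal{I}^\lambda_{(X,Y,\xi)}}\bigl(d_\mu^{X,\xi}\bigr),$$ where, by convention, $\chi_{\mathcal{I}^\lambda_{(X,Y,\xi)}}(d_\mu^{X,\xi})=0$ whenever $j>t:=m-|X|$.
   Context: **Partition algebra.** $[k]=\{1,\dots,k\}$, $[k']=\{1',\dots,k'\}$. A partition diagram is a set-partition of $[k]\cup[k']$; $\mathcal{A}_k$ is the set of them. A part is propagating if it meets both $[k]$ and $[k']$; the rank is the number of propagating parts. For $d_1,d_2\in\mathcal{A}_k$, stack $d_1$ on $d_2$, identifying $i'$ of $d_1$ with $i$ of $d_2$; $d_1\circ d_2$ is the induced set-partition on the outer rows and $c$ is the number of connected components contained in the middle row. $\mathcal{P}_k(\delta)$ has basis $\mathcal{A}_k$ and product $d_1d_2=\delta^c(d_1\circ d_2)$. The horizontal concatenation $d_1\otimes d_2$ places $d_2$ to the right of $d_1$ (with renumbering). **Standard modules.** $V(k,i)$ is the set of rank $i$ diagrams in $\mathcal{A}_k$ for which all elements of $[k']$ lie in different parts and $1',\dots,i'$ lie in propagating parts. $\mathbb{C}[V(k,i)]$ is a left $\mathcal{P}_k(\delta)$-module by $d\cdot d_1=dd_1$ if $d\circ d_1\in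 V(k,i)$ and $0$ otherwise, with commuting right action of $S_i$ permuting $1',\dots,i'$. For $\lambda\vdash i$, $\mathcal{P}_k^\lambda=\mathbb{C}[V(k,i)]\otimes_{S_i}S^\lambda$, with $S^\lambda$ the Specht module. $\chi_V(u)$ denotes the trace of $u$ on $V$. **Elements $d_\mu$.** $\gamma_i\in\mathcal{A}_i$ is the diagram of the cycle $(1,2,\dots,i)$, with parts $\{1,2'\},\{2,3'\},\dots,\{i,1'\}$, and $E_1=\{\{1\},\{1'\}\}$. For a composition $\mu=(\mu_1,\dots,\mu_l)$ of $m$ (positive parts), $d_\mu=\gamma_{\mu_1}\otimes\cdots\otimes\gamma_{\mu_l}\otimes E_1^{\otimes(k-m)}$. Let $\sigma_\mu\in S_m$ be $(1,\dots,\mu_1)(\mu_1+1,\dots,\mu_1+\mu_2)\cdots(m-\mu_l+1,\dots,m)$. For $X\subset[m]$, $\mathcal{SP}_X^\mu$ is the set of set-partitions of $X$ fixed by $\sigma_\mu$ (empty if $X$ is not $\sigma_\mu$-invariant). **Dual symmetric inverse monoid.** For a finite set $Z$, $\mathcal{I}_Z^*$ is the monoid, under vertical concatenation, of set-partitions of $Z\cup Z'$ all of whose parts are propagating; $\mathcal{I}_t^*=\mathcal{I}_{[t]}^*$. For $1\le i\le t$, $\mathcal{L}(t,i)$ is the set of rank $i$ diagrams in $\mathcal{I}_t^*$ with bottom set-partition $\{\{1'\},\dots,\{(i-1)'\},\{i',\dots,t'\}\}$. $\mathbb{C}[\mathcal{L}(t,i)]$ is a left $\mathcal{I}_t^*$-module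 (a product that leaves $\mathcal{L}(t,i)$ is $0$) with commuting right action of $G_i\cong S_i$ permuting these $i$ bottom parts, and for $\lambda\vdash i$, $\mathcal{I}_t^\lambda=\mathbb{C}[\mathcal{L}(t,i)]\otimes_{G_i}S^\lambda$, a simple module. (For $i=0$ the only non-zero case is $t=0$, where the algebra is $\mathbb{C}$ and the module is one-dimensional.) **Algebras $\mathcal{I}(X,Y,\xi)$.** For disjoint $X,Y\subset[k]$, $Z=[k]\setminus(X\cup Y)$ and a set-partition $\xi=\{A_1,\dots,A_s\}$ of $X$, $\mathcal{I}(X,Y,\xi)\subset\mathcal{P}_k(\delta)$ is the span of the diagrams with parts $A_p\cup A_p'$, singletons $\{y\},\{y'\}$ for $y\in Y$, and the parts of an arbitrary element of $\mathcal{I}_Z^*$. For $\delta\neq0$ it is a (possibly non-unital) subalgebra isomorphic to $\mathbb{C}[\mathcal{I}_Z^*]$ by sending such a diagram to $\delta^{|Y|}$ times its restriction to $Z\cup Z'$. $\mathcal{I}^\lambda_{(X,Y,\xi)}$ is the simple $\mathcal{I}(X,Y,\xi)$-module corresponding under this isomorphism, and the order-preserving bijection $Z\cong[t]$ with $t=|Z|$, to $\mathcal{I}_t^\lambda$. **Elements $d_\mu^{X,\xi}$.** For $\xi\in\mathcal{SP}_X^\mu$, $d_\mu^{X,\xi}\in\mathcal{I}(X,Y,\xi)$ coincides with $d_\mu$ outside $X\cup X'$, while its parts on $X\cup X'$ are the sets $K\cup K'$ for $K$ a part of $\xi$. *)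

(* Defs.v *)
From HB Require Import structures.
From mathcomp Require Import all_boot all_order all_algebra all_fingroup.
From mathcomp Require Import reals complex.

Set Implicit Arguments.
Unset Strict Implicit.
Unset Printing Implicit Defensive.

Import GRing.Theory.
Local Open Scope ring_scope.

(* The points of [k] u [k'], counted from 0: inl p is on the top row and inr p
   on the bottom row. *)

Definition points (k : nat) : finType := ('I_k + 'I_k)%type.

Definition diagram (k : nat) : finType :=
  {P : {set {set points k}} | partition P [set: points k]}.

Definition dparts (k : nat) (d : diagram k) : {set {set points k}} := val d.

Definition same_part (k : nat) (d : diagram k) (x y : points k) : bool :=
  y \in pblock (dparts d) x.

(* The diagram whose parts are the fibres of f. *)
Definition diag_of (k : nat) (T : eqType) (f : points k -> T) : diagram k :=
  exist _ (preim_partition f [set: points k]) (preim_partitionP f _).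

Definition propagating (k : nat) (B : {set points k}) : bool :=
  [exists p, inl p \in B] && [exists q, inr q \in B].

Definition rank (k : nat) (d : diagram k) : nat :=
  #|[set B in dparts d | propagating B]|.

(* The three rows (top + middle) + bottom of d1 stacked on top of d2. *)
Definition vertex (k : nat) : finType := ('I_k + 'I_k + 'I_k)%type.

Definition upper (k : nat) (x : points k) : vertex k := inl x.
Definition lower (k : nat) (x : points k) : vertex k :=
  match x with inl p => inl (inr p) | inr p => inr p end.
Definition outer (k : nat) (x : points k) : vertex k :=
  match x with inl p => inl (inl p) | inr p => inr p end.
Definition middle (k : nat) : {set vertex k} :=
  [set inl (inr p) | p : 'I_k].

Definition stack_rel (k : nat) (d1 d2 : diagram k) : rel (vertex k) :=
  fun u v =>
    [exists x, exists y, [&& u == upper x, v == upper y & same_part d1 x y]]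
    || [exists x, exists y, [&& u == lower x, v == lower y & same_part d2 x y]].

Definition component (k : nat) (d1 d2 : diagram k) (u : vertex k) :
    {set vertex k} :=
  [set v | connect (stack_rel d1 d2) u v].

Definition dcomp (k : nat) (d1 d2 : diagram k) : diagram k :=
  diag_of (fun x => component d1 d2 (outer x)).

Definition ncomp (k : nat) (d1 d2 : diagram k) : nat :=
  #|[set B in [set component d1 d2 u | u : vertex k] | B \subset middle k]|.

Definition dcat (k1 k2 : nat) (d1 : diagram k1) (d2 : diagram k2) :
    diagram (k1 + k2) :=
  diag_of (fun x : points (k1 + k2) =>
    match x with
    | inl p => match split p with
               | inl a => inl (pblock (dparts d1) (inl a))
               | inr b => inr (pblock (dparts d2) (inl b))
               end
    | inr p => match split p with
               | inl a => inl (pblock (dparts d1) (inr a))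
               | inr b => inr (pblock (dparts d2) (inr b))
               end
    end : {set points k1} + {set points k2}).

(* Restriction of d along an injection z of [n] into [k], applied to both rows
   and followed by renumbering. *)
Definition drestr (n k : nat) (z : 'I_n -> 'I_k) (d : diagram k) : diagram n :=
  diag_of (fun x => pblock (dparts d)
    match x with inl p => inl (z p) | inr p => inr (z p) end).

Section PartitionAlgebra.
Variables (C : fieldType) (k : nat) (delta : C).

Definition palg : vectType C := {ffun diagram k -> C^o}.

Definition dbasis (d : diagram k) : palg := [ffun e => (e == d)%:R].

Definition dmul (d1 d2 : diagram k) : palg :=
  delta ^+ ncomp d1 d2 *: dbasis (dcomp d1 d2).

Definition pmul (u v : palg) : palg :=
  \sum_d1 \sum_d2 (u d1 * v d2) *: dmul d1 d2.

End PartitionAlgebra.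

Definition vtrace (C : fieldType) (V : vectType C) (f : V -> V) : C :=
  \tr (passmx.mxof (vbasis {:V}) (vbasis {:V}) (linfun f)).

(* The quotient V / U is realised on the complement U^C of U, the projection
   V -> V / U being the projection onto U^C along U. *)
Section Quotient.
Variables (C : fieldType) (V : vectType C) (U : {vspace V}).

Definition vquot : vectType C := subvs_of (U^C)%VS.

Definition vquot_pi (v : V) : vquot := vsproj (U^C)%VS (daddv_pi (U^C) U v).

Definition vquot_map (f : V -> V) (x : vquot) : vquot := vquot_pi (f (vsval x)).

End Quotient.

(* C[B] (x)_{S_n} W, where S_n acts on the right of the finite set B through
   ract and on the left of W through lact.  A family (w_b) in {ffun B -> W}
   stands for the element \sum_b b (x) w_b of C[B] (x) W. *)
Section Tensor.
Variables (C : fieldType) (n : nat) (B : finType) (ract : B -> 'S_n -> B).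
Variables (W : vectType C) (lact : 'S_n -> W -> W).

Definition ctens : vectType C := {ffun B -> W}.

Definition pure (b : B) (w : W) : ctens :=
  [ffun b' => if b' == b then w else 0].

Definition tens_rel : {vspace ctens} :=
  <<flatten [seq [seq pure (ract x.1 x.2) w - pure x.1 (lact x.2 w)
                 | w <- vbasis {:W}] | x : B * 'S_n]>>%VS.

Definition tens : vectType C := vquot tens_rel.

(* g b is the image of b under a linear endomorphism g of C[B]; the result is
   the endomorphism induced by g (x) id. *)
Definition tens_map (g : B -> {ffun B -> C^o}) : tens -> tens :=
  vquot_map (fun f : ctens => [ffun b' => \sum_b g b b' *: f b]).

End Tensor.

Definition is_composition (mu : seq nat) (m : nat) : bool :=
  all (leq 1) mu && (sumn mu == m).

Definition is_partition (la : seq nat) (n : nat) : bool :=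
  sorted geq la && is_composition la n.

Section Specht.
Variables (C : fieldType) (n : nat) (la : seq nat).

(* Boxes (row, column) of the Young diagram of la, for la a partition of n. *)
Definition box : finType := {c : 'I_n * 'I_n | (c.2 < nth 0 la c.1)%N}.

Definition tableau : finType := {T : {ffun box -> 'I_n} | injectiveb T}.

Definition trow (T : tableau) (r : 'I_n) : {set 'I_n} :=
  [set val T c | c : box & (val c).1 == r].
Definition tcol (T : tableau) (q : 'I_n) : {set 'I_n} :=
  [set val T c | c : box & (val c).2 == q].

(* A tabloid is recorded as the family of the sets of entries of its rows. *)
Definition tabloid : finType := {ffun 'I_n -> {set 'I_n}}.
Definition tabloid_of (T : tableau) : tabloid := [ffun r => trow T r].

(* s applied to every entry. *)
Definition tabloid_perm (s : 'S_n) (A : tabloid) : tabloid :=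
  [ffun r => s @: A r].

Definition col_stab (T : tableau) : {set 'S_n} :=
  [set s : 'S_n | [forall q, s @: tcol T q == tcol T q]].

Definition tabmod : vectType C := {ffun tabloid -> C^o}.

Definition polytabloid (T : tableau) : tabmod :=
  \sum_(s in col_stab T) (-1) ^+ odd_perm s *:
    ([ffun A => (A == tabloid_perm s (tabloid_of T))%:R] : tabmod).

Definition specht_vs : {vspace tabmod} := <<[seq polytabloid T | T : tableau]>>.

Definition specht : vectType C := subvs_of specht_vs.

(* In 'S_n the product s * t means "first s, then t", so the left action is
   s . {T} = {s^-1 T}; hence the coefficient of s . f at {T} is that of f
   at {s T}. *)
Definition specht_act (s : 'S_n) (w : specht) : specht :=
  vsproj specht_vs ([ffun A => vsval w (tabloid_perm s A)] : tabmod).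

End Specht.

(* If the points on the bottom row of a diagram d are coloured by col, with
   values < i naming i of its parts and the value of the point p being the name
   of its part, then dperm col d s moves the part named a to the place s a:
   the point p' takes the part of the point s^-1 (col p). *)
Definition bot_perm (k i : nat) (col : 'I_k -> nat) (s : 'S_i) (p : 'I_k) :
    'I_k :=
  if insub (col p) is Some a then insubd p (val ((s^-1)%g a)) else p.

Definition dperm (k i : nat) (col : 'I_k -> nat) (d : diagram k) (s : 'S_i) :
    diagram k :=
  diag_of (fun x => pblock (dparts d)
    match x with inl p => inl p | inr p => inr (bot_perm col s p) end).

Section Standard.
Variables (k i : nat).

Definition in_V (d : diagram k) : bool :=
  [&& rank d == i,
      [forall p, forall q, same_part d (inr p) (inr q) ==> (p == q)] &
      [forall p : 'I_k,
         (p < i)%N ==> propagating (pblock (dparts d) (inr p))]].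

Definition Vki : finType := {d : diagram k | in_V d}.

(* in_V is stable under dperm val, so the default b is never used. *)
Definition V_ract (b : Vki) (s : 'S_i) : Vki :=
  insubd b (dperm val (val b) s).

Variables (C : fieldType) (delta : C) (la : seq nat).

(* u . b is the product u b in the algebra, truncated to the span of V(k,i). *)
Definition V_lact (u : palg C k) (b : Vki) : {ffun Vki -> C^o} :=
  [ffun b' : Vki => pmul delta u (dbasis C (val b)) (val b')].

Definition Pmod : vectType C := tens V_ract (@specht_act C i la).

Definition Pmod_act (u : palg C k) : Pmod -> Pmod := tens_map (V_lact u).

Definition chi_P (u : palg C k) : C := vtrace (Pmod_act u).

End Standard.

Definition all_propagating (k : nat) (d : diagram k) : bool :=
  [forall B in dparts d, propagating B].

Definition Istar (t : nat) : finType := {d : diagram t | all_propagating d}.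

Section DualSymmetricInverse.
Variables (t i : nat).

(* Number (from 0) of the bottom part containing the point p' in the bottom
   set-partition {{1'}, ..., {(i-1)'}, {i', ..., t'}}. *)
Definition Lcol (p : 'I_t) : nat := minn p i.-1.

Definition in_L (d : diagram t) : bool :=
  [&& all_propagating d, rank d == i &
      [forall p, forall q,
         same_part d (inr p) (inr q) == (Lcol p == Lcol q)]].

Definition Lti : finType := {d : diagram t | in_L d}.

(* in_L is stable under dperm Lcol, so the default b is never used. *)
Definition L_ract (b : Lti) (s : 'S_i) : Lti :=
  insubd b (dperm Lcol (val b) s).

Variables (C : fieldType) (la : seq nat).

Definition L_lact (u : {ffun Istar t -> C^o}) (b : Lti) : {ffun Lti -> C^o} :=
  [ffun b' : Lti => \sum_(d : Istar t | dcomp (val d) (val b) == val b') u d].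

Definition Imod : vectType C := tens L_ract (@specht_act C i la).

Definition Imod_act (u : {ffun Istar t -> C^o}) : Imod -> Imod :=
  tens_map (L_lact u).

Definition chi_Istar (u : {ffun Istar t -> C^o}) : C := vtrace (Imod_act u).

End DualSymmetricInverse.

(* K u K' *)
Definition doubled (k : nat) (K : {set 'I_k}) : {set points k} :=
  [set inl p | p in K] :|: [set inr p | p in K].

Section SubalgebraXY.
Variables (C : fieldType) (k : nat) (delta : C).
Variables (X Y : {set 'I_k}) (xi : {set {set 'I_k}}).

Definition Zset : {set 'I_k} := ~: (X :|: Y).

Definition Iset : {set diagram k} :=
  [set d : diagram k |
    [&& [forall A in xi, doubled A \in dparts d],
        [forall y in Y, ([set inl y] \in dparts d)
                        && ([set inr y] \in dparts d)] &
        [forall B in dparts d, (B \subset doubled Zset) ==> propagating B]]].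

Definition Ialg : {vspace palg C k} := <<[seq dbasis C d | d in Iset]>>.

(* Restriction to Z u Z', renumbered along the order-preserving bijection
   enum_val between [t] and Z. *)
Definition restrZ (d : diagram k) : diagram #|Zset| := drestr enum_val d.

(* The isomorphism from I(X, Y, xi) to C[I_t^*], sending a diagram d of Iset to
   delta^|Y| times its restriction; it is extended to the whole algebra by 0 on
   the diagrams outside Iset. *)
Definition Iiso (u : palg C k) : {ffun Istar #|Zset| -> C^o} :=
  [ffun e : Istar #|Zset| =>
     \sum_(d in Iset | restrZ d == val e) delta ^+ #|Y| * u d].

(* The character of the simple module of I(X, Y, xi) indexed by the partition
   la of j, zero by convention for j > t. It is meaningful for u in Ialg. *)
Definition chi_I (j : nat) (la : seq nat) (u : palg C k) : C :=
  if (#|Zset| < j)%N then 0 else chi_Istar j la (Iiso u).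

End SubalgebraXY.

(* The parts are {1, 2'}, {2, 3'}, ..., {n, 1'}. *)
Definition dgamma (n : nat) : diagram n :=
  diag_of (fun x => match x with inl p => ordS p | inr q => q end).

Definition dE1 : diagram 1 := diag_of id.

Definition dempty : diagram 0 := diag_of id.

Fixpoint dgammas (mu : seq nat) : diagram (sumn mu) :=
  match mu return diagram (sumn mu) with
  | [::] => dempty
  | a :: mu' => dcat (dgamma a) (dgammas mu')
  end.

Fixpoint dEs (r : nat) : diagram r :=
  match r return diagram r with
  | 0 => dempty
  | r'.+1 => dcat dE1 (dEs r')
  end.

Definition d_mu (k : nat) (mu : seq nat) (hm : (sumn mu <= k)%N) : diagram k :=
  drestr (cast_ord (esym (subnKC hm))) (dcat (dgammas mu) (dEs (k - sumn mu))).

Fixpoint sigma_fun (mu : seq nat) : 'I_(sumn mu) -> 'I_(sumn mu) :=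
  match mu return 'I_(sumn mu) -> 'I_(sumn mu) with
  | [::] => id
  | a :: mu' => fun p : 'I_(a + sumn mu') =>
      match split p with
      | inl q => lshift (sumn mu') (ordS q)
      | inr q => rshift a (sigma_fun q)
      end
  end.

Lemma sigma_fun_inj (mu : seq nat) : injective (@sigma_fun mu).
Proof.
have sl m n (p : 'I_m) : split (lshift n p) = inl p := unsplitK (inl p).
have sr m n (p : 'I_n) : split (rshift m p) = inr p := unsplitK (inr p).
elim: mu => [|a mu IH] p q //=.
case: (split_ordP p) => p' ->; case: (split_ordP q) => q' ->; rewrite ?sl ?sr.
- by move/lshift_inj/ordS_inj=> ->.
- by move/eqP; rewrite eq_lrshift.
- by move/eqP; rewrite eq_rlshift.
- by move/rshift_inj/IH=> ->.
Qed.

Definition sigma_mu (mu : seq nat) : 'S_(sumn mu) := perm (@sigma_fun_inj mu).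

(* A set-partition of X fixed by sigma_mu forces X to be sigma_mu-invariant. *)
Definition SP (mu : seq nat) (X : {set 'I_(sumn mu)}) :
    {set {set {set 'I_(sumn mu)}}} :=
  [set xi | partition xi X & [set sigma_mu mu @: K | K : {set _} in xi] == xi].

(* Inclusion of [m] in [k], on subsets and on set-partitions of subsets. *)
Definition widen_set (m k : nat) (hm : (m <= k)%N) (X : {set 'I_m}) :
    {set 'I_k} :=
  [set widen_ord hm p | p in X].
Definition widen_sets (m k : nat) (hm : (m <= k)%N) (xi : {set {set 'I_m}}) :
    {set {set 'I_k}} :=
  [set widen_set hm K | K : {set _} in xi].

Definition d_mu_X (k : nat) (mu : seq nat) (hm : (sumn mu <= k)%N)
    (X : {set 'I_k}) (xi : {set {set 'I_k}}) : diagram k :=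
  let part x := pblock (dparts (d_mu hm)) x in
  diag_of (fun x : points k =>
    match x with
    | inl p => if p \in X then inl (pblock xi p) else inr (part (inl p))
    | inr p => if p \in X then inl (pblock xi p) else inr (part (inr p))
    end : {set 'I_k} + {set points k}).

(* Main.v *)
From HB Require Import structures.
Require Import Defs.
From mathcomp Require Import all_boot all_order all_algebra all_fingroup.
From mathcomp Require Import reals complex.
Import GRing.Theory.
Local Open Scope ring_scope.

Set Implicit Arguments.
Unset Strict Implicit.
Unset Printing Implicit Defensive.

(** Both sides are traces on spaces of the form [C[B] (x)_{S_j} W], where [W] is
    the Specht module and [B] is a finite set of diagrams, [V(k,j)] on the left
    and [L(t,j)] on the right.  In characteristic zero such a space is the image
    of the averaging projection over [S_j], which gives the trace of an
    equivariant [g] as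

      [1/j! * \sum_s chi_W(s) * \sum_b (coefficient of b.s in g b)]

    (vtrace_tens_map).  The formula therefore reduces, for each [s] in [S_j], to
    counting with weights the diagrams [b] such that [d o b = b.s].

    The diagram [d_mu] acts on the points of [[m]] by the permutation
    [sigma = sigma_mu] and isolates the points of [Y].  If [d_mu o b = b.s],
    then the points of [Y] are isolated in the top row of [b], and each of them
    is a component of the middle row; there are no other such components, so
    the weight is [delta^|Y|] (ncomp_isolated).  That is also the factor
    contributed by the isomorphism from [I(X,Y,xi)] to the algebra of the dual
    symmetric inverse monoid.

    It remains to count.  A diagram [b] of [V(k,j)] whose points of [Y] are
    isolated amounts to a pair [(c, xi)]: [c] sends a point of [[m]] to the
    bottom point among [1',...,j'] that belongs to its part, if any, and [xi] is
    the set-partition cut out by [b] on the set [X] of points left unlabelled.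
    The equation [d_mu o b = b.s] says that [c] intertwines [sigma] with [s] and
    that [xi] is fixed by [sigma] (card_fixed_V).  For given [X] and [xi], the
    diagram [d_mu^{X,xi}] restricts to the permutation [sigma] of [[m] \ X], and
    the diagrams of [L(t,j)] satisfying the corresponding equation are the same
    labelings [c] with unlabelled set [X] (card_fixed_L).  A labeling uses all
    [j] labels, so that none exists for [j > t], in accordance with the
    convention on the right-hand side. *)

(** * Traces on coinvariants *)

Section LinearFunctions.
Variables (C : fieldType).

Lemma linfun_funE (U V : vectType C) (f : U -> V) : linear f -> linfun f =1 f.
Proof.
move=> lf; pose F : {linear U -> V} :=
  HB.pack f (GRing.isLinear.Build _ _ _ _ f lf).
exact: (lfunE F).
Qed.

Lemma linear_fun_sum (U V : vectType C) (f : U -> V) (I : finType)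
    (F : I -> U) :
  linear f -> f (\sum_i F i) = \sum_i f (F i).
Proof.
move=> lf; pose f' : {linear U -> V} :=
  HB.pack f (GRing.isLinear.Build _ _ _ _ f lf).
exact: (linear_sum f').
Qed.

(** [vtrace] of a bundled endomorphism, so as to state that the trace is
    linear. *)
Definition ltrace (V : vectType C) (f : 'End(V)) : C :=
  \tr (passmx.mxof (vbasis {:V}) (vbasis {:V}) f).

Lemma ltrace_mulC (U V : vectType C) (f : 'Hom(U, V)) (g : 'Hom(V, U)) :
  ltrace (f \o g)%VF = ltrace (g \o f)%VF.
Proof.
rewrite /ltrace (passmx.mxof_comp _ _ (vbasisP {:U})).
by rewrite (passmx.mxof_comp _ _ (vbasisP {:V})) mxtrace_mulC.
Qed.

Lemma ltrace_is_scalar (V : vectType C) : scalar (@ltrace V).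
Proof.
by move=> a f g; rewrite /ltrace passmx.mxof_linear mxtraceD mxtraceZ.
Qed.

HB.instance Definition _ (V : vectType C) :=
  GRing.isLinear.Build C 'End(V) C *%R (@ltrace V) (@ltrace_is_scalar V).

(** The trace on [V / U] is the trace of [f o p] for the projection [p] chosen
    to realise the quotient.  As [p] and [e] have the same kernel, [p e = p] and
    [e p = e], so that, [f] commuting with [e],
    [tr (f p) = tr (p f e) = tr (f e p) = tr (f e)]. *)
Lemma ltrace_vquot (V : vectType C) (U : {vspace V}) (f : V -> V)
    (e : 'End(V)) :
  linear f -> {in U, e =1 fun=> 0} -> (forall v, v - e v \in U) ->
  (forall v, f (e v) = e (f v)) ->
  vtrace (vquot_map (U := U) f) = ltrace (linfun f \o e)%VF.
Proof.
move=> lf eU e1 fe.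
have lF : linfun f =1 f := linfun_funE lf.
pose p := daddv_pi (U^C) U.
have dis : (U^C :&: U)%VS = 0%VS by rewrite capvC capv_compl.
have pU v : v - p v \in U.
  have /(daddv_pi_add dis) : v \in (U^C + U)%VS.
    by rewrite addvC addv_complf memvf.
  by move=> {1}<-; rewrite addrC addKr memv_pi.
have p0 u : u \in U -> p u = 0.
  move=> uU; have := daddv_pi_add (capv_compl U).
  move=> /(_ u); rewrite addv_complf memvf => /(_ isT).
  rewrite daddv_pi_id ?capv_compl // => /eqP.
  by rewrite -subr_eq0 addrC addKr => /eqP.
have ep v : e (p v) = e v.
  by have /eqP := eU _ (pU v); rewrite linearB subr_eq0 => /eqP.
have pe v : p (e v) = p v.
  by have /eqP := p0 _ (e1 v); rewrite linearB subr_eq0 => /eqP.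
have linA : linear (vsval : vquot U -> V) by move=> a x y; rewrite linearP.
have linB : linear (@vquot_pi C V U).
  by move=> a x y; rewrite /vquot_pi linearP linearP.
pose A := linfun (vsval : vquot U -> V).
pose B := linfun (@vquot_pi C V U).
have AE : A =1 vsval := linfun_funE linA.
have BE : B =1 @vquot_pi C V U := linfun_funE linB.
have lq : linear (vquot_map (U := U) f).
  by move=> a x y; rewrite /vquot_map linA lf linB.
have -> : vtrace (vquot_map (U := U) f) = ltrace ((B \o linfun f) \o A)%VF.
  rewrite /vtrace /ltrace; congr (\tr (passmx.mxof _ _ _)).
  by apply/lfunP => x; rewrite (linfun_funE lq) !comp_lfunE /= AE lF BE.
rewrite ltrace_mulC.
have -> : (A \o (B \o linfun f))%VF = (p \o linfun f)%VF.
  apply/lfunP => x; rewrite !comp_lfunE AE BE lF /vquot_pi vsprojK //.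
  exact: memv_pi.
have -> : (p \o linfun f = p \o (linfun f \o e))%VF.
  by apply/lfunP => x; rewrite !comp_lfunE !lF fe pe.
rewrite [LHS]ltrace_mulC; congr (ltrace _).
by apply/lfunP => x; rewrite !comp_lfunE !lF ep.
Qed.

End LinearFunctions.

Section TensorTrace.
Variables (C : fieldType) (n : nat) (B : finType) (ract : B -> 'S_n -> B).
Variables (W : vectType C) (lact : 'S_n -> W -> W).
Hypothesis ract1 : forall b, ract b 1%g = b.
Hypothesis ractM : forall b s t, ract (ract b s) t = ract b (s * t)%g.
Hypothesis lact_lin : forall s, linear (lact s).
Hypothesis lactM : forall s t w, lact (s * t)%g w = lact s (lact t w).
Hypothesis fact_neq0 : n`!%:R != 0 :> C.

Let ractK s : cancel (ract^~ s) (ract^~ s^-1%g).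
Proof. by move=> b; rewrite ractM mulgV ract1. Qed.

Let ractVK s : cancel (ract^~ s^-1%g) (ract^~ s).
Proof. by move=> b; rewrite ractM mulVg ract1. Qed.

Let lact0 s : lact s 0 = 0.
Proof. by rewrite -(linfun_funE (lact_lin s)) linear0. Qed.

Let lactZ s a w : lact s (a *: w) = a *: lact s w.
Proof. by rewrite -!(linfun_funE (lact_lin s)) linearZ. Qed.

Let lact_sum s (I : finType) (F : I -> W) :
  lact s (\sum_i F i) = \sum_i lact s (F i).
Proof. exact: linear_fun_sum. Qed.

(** As [s] sends [b (x) w] to [b s^-1 (x) s w], the value of the image at [b]
    comes from the value at [b s]. *)
Definition diag_act (s : 'S_n) (f : ctens B W) : ctens B W :=
  [ffun b => lact s (f (ract b s))].

Definition average_fun (f : ctens B W) : ctens B W :=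
  n`!%:R^-1 *: \sum_(s : 'S_n) diag_act s f.

Let average_funE f b :
  average_fun f b = n`!%:R^-1 *: \sum_(s : 'S_n) lact s (f (ract b s)).
Proof.
rewrite !ffunE sum_ffunE; congr (_ *: _).
by apply: eq_bigr => s _; rewrite ffunE.
Qed.

Lemma average_fun_linear : linear average_fun.
Proof.
move=> a f g; apply/ffunP => b.
have -> : (a *: average_fun f + average_fun g) b =
    a *: average_fun f b + average_fun g b by rewrite !ffunE.
rewrite !average_funE.
rewrite scalerA mulrC -scalerA -scalerDr; congr (_ *: _).
rewrite scaler_sumr -big_split; apply: eq_bigr => s _ /=.
by rewrite !ffunE lact_lin.
Qed.

Definition average : 'End(ctens B W) := linfun average_fun.

Let averageE f : average f = average_fun f.
Proof. exact: (linfun_funE average_fun_linear). Qed.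

Lemma pure_linear (b : B) : linear (@pure C B W b).
Proof.
move=> a x y; apply/ffunP => b'; rewrite !ffunE.
by case: eqP => // _; rewrite scaler0 addr0.
Qed.

Let pureZ (b : B) a (w : W) : pure b (a *: w) = a *: pure b w.
Proof. by rewrite -!(linfun_funE (pure_linear b)) linearZ. Qed.

Lemma pure_rel_mem b s w :
  pure (ract b s) w - pure b (lact s w) \in tens_rel ract lact.
Proof.
rewrite (coord_vbasis (memvf w)) lact_sum.
rewrite !(linear_fun_sum _ (@pure_linear _)) -sumrB.
apply: memv_suml => i _; rewrite lactZ.
rewrite !pureZ -scalerBr memvZ // memv_span //.
apply/flattenP; eexists; first exact: (map_f _ (mem_enum _ (b, s))).
by apply/mapP; exists (vbasis {:W})`_i; rewrite ?mem_nth ?size_tuple.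
Qed.

Lemma ctens_sum (f : ctens B W) : f = \sum_b pure b (f b).
Proof.
apply/ffunP => b; rewrite sum_ffunE (bigD1 b) //= ffunE eqxx big1 ?addr0 //.
by move=> b' /negPf b'b; rewrite ffunE eq_sym b'b.
Qed.

Lemma average_tens_rel : {in tens_rel ract lact, average =1 fun=> 0}.
Proof.
move=> f fU; apply/eqP; rewrite -memv_ker; move: f fU; apply/subvP.
apply/span_subvP => _ /flattenP[_ /mapP[[b t] _ ->] /mapP[w _ ->]] /=.
rewrite memv_ker linearB /= subr_eq0; apply/eqP; rewrite !averageE.
apply/ffunP => b'; rewrite !average_funE; congr (_ *: _).
rewrite (reindex_inj (mulIg t)); apply: eq_bigr => s _ /=.
rewrite !ffunE -ractM (can_eq (ractK t)) lactM.
by case: eqP; rewrite ?lact0.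
Qed.

Lemma sub_average_mem f : f - average f \in tens_rel ract lact.
Proof.
have -> : f - average f = n`!%:R^-1 *: \sum_(s : 'S_n) (f - diag_act s f).
  rewrite sumrB sumr_const card_Sn -scaler_nat scalerBr scalerA mulVf //.
  by rewrite scale1r averageE.
rewrite memvZ // memv_suml // => s _.
have -> : f - diag_act s f =
    \sum_b (pure b (f b) - pure (ract b s^-1%g) (lact s (f b))).
  rewrite sumrB -ctens_sum; congr (_ - _).
  rewrite [LHS]ctens_sum (reindex_inj (can_inj (ractVK s))).
  by apply: eq_bigr => b _; rewrite ffunE ractVK.
apply: memv_suml => b _.
by rewrite -{1}[b](ractVK s) pure_rel_mem.
Qed.

Variable (g : B -> {ffun B -> C^o}).
Hypothesis g_ract : forall b b' s, g (ract b s) (ract b' s) = g b b'.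

(** The averaging operator is a projection whose kernel is the space of tensor
    relations, so the trace of the map induced by [g] is that of [g (x) id]
    composed with it, which is read on the diagonal blocks [b (x) W]. *)
Theorem vtrace_tens_map :
  vtrace (tens_map (ract := ract) (lact := lact) g) =
  n`!%:R^-1 * \sum_(s : 'S_n) vtrace (lact s) * \sum_b g b (ract b s).
Proof.
rewrite /tens_map.
set G := fun f : ctens B W => _.
have Glin : linear G.
  move=> a x y; apply/ffunP => b; rewrite !ffunE scaler_sumr -big_split.
  apply: eq_bigr => b' _ /=.
  by rewrite !ffunE scalerDr !scalerA mulrC.
have Gavg f : G (average f) = average (G f).
  apply/ffunP => b'; rewrite !averageE average_funE ffunE.
  under eq_bigr do rewrite average_funE scalerA mulrC -scalerA.
  rewrite -scaler_sumr; congr (_ *: _).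
  under eq_bigr do rewrite scaler_sumr.
  rewrite exchange_big; apply: eq_bigr => s _ /=.
  rewrite ffunE lact_sum (reindex_inj (can_inj (ractVK s))).
  apply: eq_bigr => b _ /=; rewrite lactZ ractVK.
  by rewrite -(g_ract _ _ s) ractVK.
rewrite (ltrace_vquot Glin average_tens_rel sub_average_mem Gavg).
set T := (_ \o _)%VF.
pose ev b := linfun (fun f : ctens B W => f b).
have evE b f : ev b f = f b.
  apply: (@linfun_funE _ _ _ (fun f : ctens B W => f b)) => a x y.
  by rewrite !ffunE.
have -> : T = \sum_b ((T \o linfun (@pure C B W b)) \o ev b)%VF.
  apply/lfunP => f; rewrite sum_lfunE [in LHS](ctens_sum f) linear_sum.
  apply: eq_bigr => b _.
  by rewrite /= !comp_lfunE evE (linfun_funE (@pure_linear b)).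
have trE b : ltrace ((T \o linfun (@pure C B W b)) \o ev b)%VF =
    n`!%:R^-1 * \sum_(s : 'S_n) vtrace (lact s) * g b (ract b s).
  rewrite ltrace_mulC.
  have -> : (ev b \o (T \o linfun (@pure C B W b)))%VF =
      n`!%:R^-1 *: \sum_(s : 'S_n) g b (ract b s) *: linfun (lact s).
    apply/lfunP => w; rewrite !comp_lfunE evE (linfun_funE (@pure_linear b)).
    rewrite (linfun_funE Glin) /G ffunE averageE scale_lfunE sum_lfunE.
    under eq_bigr do rewrite average_funE scalerA mulrC -scalerA.
    rewrite -scaler_sumr; congr (_ *: _).
    under eq_bigr do rewrite scaler_sumr.
    rewrite exchange_big; apply: eq_bigr => s _ /=.
    rewrite scale_lfunE (linfun_funE (lact_lin s)).
    rewrite (bigD1 (ract b s^-1%g)) //= ffunE ractVK eqxx big1 ?addr0.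
      by rewrite -(g_ract _ _ s) ractVK.
    move=> b' b'b; rewrite ffunE; case: eqP => [bE|]; last first.
      by rewrite lact0 scaler0.
    by case/eqP: b'b; rewrite -bE ractK.
  rewrite linearZ /= linear_sum; congr (_ * _); apply: eq_bigr => s _.
  by rewrite linearZ /= mulrC.
rewrite linear_sum /=; under eq_bigr do rewrite trE.
rewrite -mulr_sumr exchange_big; congr (_ * _); apply: eq_bigr => s _ /=.
by rewrite -mulr_sumr.
Qed.

End TensorTrace.

(** * The action on Specht modules *)

Section SpechtAction.
Variables (C : fieldType) (n : nat) (la : seq nat).

Lemma tabloid_perm1 (A : tabloid n) : tabloid_perm 1%g A = A.
Proof.
apply/ffunP => r; rewrite ffunE -[RHS]imset_id.
by apply: eq_imset => x; rewrite perm1.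
Qed.

Lemma tabloid_permM (s t : 'S_n) (A : tabloid n) :
  tabloid_perm (s * t)%g A = tabloid_perm t (tabloid_perm s A).
Proof.
apply/ffunP => r; rewrite !ffunE -imset_comp.
by apply: eq_imset => x; rewrite permM.
Qed.

Lemma tabloid_permK (s : 'S_n) :
  cancel (@tabloid_perm n s) (@tabloid_perm n s^-1%g).
Proof. by move=> A; rewrite -tabloid_permM mulgV tabloid_perm1. Qed.

Lemma tableau_perm_inj (s : 'S_n) (T : tableau n la) :
  injectiveb [ffun c => s (val T c)].
Proof.
apply/injectiveP => c1 c2; rewrite !ffunE => /perm_inj.
exact/injectiveP/(valP T).
Qed.

Definition tableau_perm (s : 'S_n) (T : tableau n la) : tableau n la :=
  Sub [ffun c => s (val T c)] (tableau_perm_inj s T).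

Lemma trow_perm s T r : trow (tableau_perm s T) r = s @: trow T r.
Proof. by rewrite /trow -imset_comp; apply: eq_imset => c; rewrite ffunE. Qed.

Lemma tcol_perm s T q : tcol (tableau_perm s T) q = s @: tcol T q.
Proof. by rewrite /tcol -imset_comp; apply: eq_imset => c; rewrite ffunE. Qed.

Lemma tabloid_of_perm s T :
  tabloid_of (tableau_perm s T) = tabloid_perm s (tabloid_of T).
Proof. by apply/ffunP => r; rewrite !ffunE trow_perm. Qed.

Lemma col_stab_perm s u T :
  ((u ^ s)%g \in col_stab (tableau_perm s T)) = (u \in col_stab T).
Proof.
rewrite !inE; apply: eq_forallb => q; rewrite tcol_perm -imset_comp.
have -> : [set ((u ^ s)%g \o s) x | x in tcol T q] = s @: (u @: tcol T q).
  rewrite -[RHS]imset_comp; apply: eq_imset => x /=.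
  by rewrite conjgE !permM permK.
by rewrite (inj_eq (imset_inj (@perm_inj _ s))).
Qed.

(** Transporting a tableau by [s] conjugates its column stabiliser by [s], which
    keeps the signs. *)
Lemma polytabloid_perm s T A :
  polytabloid C (tableau_perm s T) (tabloid_perm s A) = polytabloid C T A.
Proof.
rewrite !sum_ffunE (reindex_inj (conjg_inj s)).
apply: eq_big => [u|u _]; first by rewrite col_stab_perm.
rewrite !ffunE odd_permJ tabloid_of_perm -tabloid_permM.
by rewrite conjgE mulKVg tabloid_permM (can_eq (tabloid_permK s)).
Qed.

Lemma specht_vs_perm s (f : tabmod C n) :
  f \in specht_vs C n la ->
  [ffun A => f (tabloid_perm s A)] \in specht_vs C n la.
Proof.
pose F := linfun (fun f : tabmod C n =>
  [ffun A => f (tabloid_perm s A)] : tabmod C n).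
have FE f' : F f' = [ffun A => f' (tabloid_perm s A)].
  apply: (@linfun_funE _ _ _ (fun f : tabmod C n =>
    [ffun A => f (tabloid_perm s A)] : tabmod C n)) => a x y.
  by apply/ffunP => A; rewrite !ffunE.
move=> fS; rewrite -FE.
suff : (F @: specht_vs C n la <= specht_vs C n la)%VS.
  by move/subvP; apply; apply: memv_img.
rewrite limg_span; apply/span_subvP => _ /mapP[_ /mapP[T _ ->] ->].
have -> : F (polytabloid C T) = polytabloid C (tableau_perm s^-1%g T).
  apply/ffunP => A; rewrite FE ffunE -(polytabloid_perm s^-1%g).
  by rewrite tabloid_permK.
by rewrite memv_span // map_f ?mem_enum.
Qed.

Lemma vsval_specht_act s (w : specht C n la) A :
  vsval (specht_act s w) A = vsval w (tabloid_perm s A).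
Proof. by rewrite vsprojK ?ffunE // specht_vs_perm // subvsP. Qed.

Lemma specht_act_linear s : linear (@specht_act C n la s).
Proof.
move=> a x y; apply/val_inj/ffunP => A.
by rewrite vsval_specht_act !linearP !ffunE !vsval_specht_act.
Qed.

Lemma specht_actM s t w :
  @specht_act C n la (s * t)%g w = specht_act s (specht_act t w).
Proof.
by apply/val_inj/ffunP => A; rewrite !vsval_specht_act tabloid_permM.
Qed.

End SpechtAction.

(** * Diagrams as equivalence relations *)

Section SamePart.
Variable k : nat.
Implicit Types (d : diagram k) (x y z : points k).

Lemma dparts_partition d : partition (dparts d) [set: points k].
Proof. exact: (valP d). Qed.

Lemma dparts_trivIset d : trivIset (dparts d).
Proof. by case/and3P: (dparts_partition d). Qed.

Lemma mem_cover_dparts d x : x \in cover (dparts d).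
Proof. by rewrite (cover_partition (dparts_partition d)) inE. Qed.

Lemma eq_pblock_dparts d x y :
  (pblock (dparts d) x == pblock (dparts d) y) = same_part d x y.
Proof. by rewrite eq_pblock ?dparts_trivIset ?mem_cover_dparts. Qed.

Lemma pblock_dparts_mem d x : pblock (dparts d) x \in dparts d.
Proof. by rewrite pblock_mem ?mem_cover_dparts. Qed.

Lemma dparts_pblock d (B : {set points k}) :
  B \in dparts d -> exists2 x, x \in B & B = pblock (dparts d) x.
Proof.
move=> Bd; have /and3P[_ _ /negPf n0] := dparts_partition d.
have /set0Pn[x xB] : B != set0 by apply: contraFneq n0 => <-.
by exists x => //; rewrite (def_pblock (dparts_trivIset d) Bd xB).
Qed.

Lemma same_part_refl d x : same_part d x x.
Proof. by rewrite -eq_pblock_dparts. Qed.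

Lemma same_part_sym d x y : same_part d x y = same_part d y x.
Proof. by rewrite -!eq_pblock_dparts eq_sym. Qed.

Lemma same_part_trans d y x z :
  same_part d x y -> same_part d y z -> same_part d x z.
Proof. by rewrite -!eq_pblock_dparts => /eqP ->. Qed.

Lemma same_part_left d x y z :
  same_part d x y -> same_part d x z = same_part d y z.
Proof. by rewrite -!eq_pblock_dparts => /eqP ->. Qed.

Lemma same_part_diag_of (T : eqType) (f : points k -> T) x y :
  same_part (diag_of f) x y = (f x == f y).
Proof.
rewrite /same_part pblock_equivalence_partition ?inE //.
by move=> a b c _ _ _; split=> // /eqP ->.
Qed.

(** Set-partitions are handled through their equivalence relations, in which all
    the constructions on diagrams become pullbacks along maps of points. *)
Lemma diagP d d' : same_part d =2 same_part d' -> d = d'.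
Proof.
move=> dd'; apply: val_inj; rewrite /= -[LHS](preim_partition_pblock (valP d)).
rewrite -[RHS](preim_partition_pblock (valP d')).
apply: eq_imset => x; apply/setP => y; rewrite !inE /=.
by rewrite !eq_pblock_dparts dd'.
Qed.

End SamePart.

Definition both (A B : Type) (f : A -> B) (x : A + A) : B + B :=
  match x with inl p => inl (f p) | inr p => inr (f p) end.

Definition on_bottom (A : Type) (f : A -> A) (x : A + A) : A + A :=
  match x with inl p => inl p | inr p => inr (f p) end.

Lemma same_part_drestr n k (z : 'I_n -> 'I_k) (d : diagram k) x y :
  same_part (drestr z d) x y = same_part d (both z x) (both z y).
Proof. by rewrite /drestr same_part_diag_of eq_pblock_dparts. Qed.

Lemma same_part_dperm k i (col : 'I_k -> nat) (d : diagram k) (s : 'S_i) x y :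
  same_part (dperm col d s) x y =
  same_part d (on_bottom (bot_perm col s) x) (on_bottom (bot_perm col s) y).
Proof. by rewrite same_part_diag_of eq_pblock_dparts. Qed.

Section Concatenation.
Variables (k1 k2 : nat) (d1 : diagram k1) (d2 : diagram k2).

Lemma same_part_dcat_l (x y : points k1) :
  same_part (dcat d1 d2) (both (lshift k2) x) (both (lshift k2) y) =
  same_part d1 x y.
Proof.
have sl (p : 'I_k1) : split (lshift k2 p) = inl p := unsplitK (inl p).
rewrite -(eq_pblock_dparts d1) /dcat same_part_diag_of.
by case: x y => p [] q /=; rewrite !sl.
Qed.

Lemma same_part_dcat_r (x y : points k2) :
  same_part (dcat d1 d2) (both (@rshift k1 k2) x) (both (@rshift k1 k2) y) =
  same_part d2 x y.
Proof.
have sr (p : 'I_k2) : split (rshift k1 p) = inr p := unsplitK (inr p).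
rewrite -(eq_pblock_dparts d2) /dcat same_part_diag_of.
by case: x y => p [] q /=; rewrite !sr.
Qed.

Lemma same_part_dcat_lr (x : points k1) (y : points k2) :
  same_part (dcat d1 d2) (both (lshift k2) x) (both (@rshift k1 k2) y) = false.
Proof.
have sl (p : 'I_k1) : split (lshift k2 p) = inl p := unsplitK (inl p).
have sr (p : 'I_k2) : split (rshift k1 p) = inr p := unsplitK (inr p).
rewrite /dcat same_part_diag_of.
by case: x y => p [] q /=; rewrite ?sl ?sr.
Qed.

Lemma same_part_dcat_rl (x : points k2) (y : points k1) :
  same_part (dcat d1 d2) (both (@rshift k1 k2) x) (both (lshift k2) y) = false.
Proof. by rewrite same_part_sym same_part_dcat_lr. Qed.

End Concatenation.

(** * Partial permutation diagrams *)

(** The diagram with parts [{p, (pi p)'}] for [p] in [D], all other points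
    being isolated. *)
Definition pperm_diag (k : nat) (D : {set 'I_k}) (pi : 'I_k -> 'I_k)
    (d : diagram k) : Prop :=
  [/\ forall p q, same_part d (inl p) (inl q) = (p == q),
      forall p q, same_part d (inr p) (inr q) = (p == q) &
      forall p q, same_part d (inl p) (inr q) = (p \in D) && (q == pi p)].

Section CycleDiagrams.

Lemma same_part_dEs r (x y : points r) : same_part (dEs r) x y = (x == y).
Proof.
elim: r x y => [|r IH]; first by case=> -[].
have E1 (a b : points 1) : same_part dE1 a b = (a == b).
  by rewrite /dE1 same_part_diag_of.
have bE (x : points (1 + r)) :
    (exists a, x = both (lshift r) a) \/ (exists a, x = both (@rshift 1 r) a).
  case: x => p; case: (split_ordP p) => q ->.
  - by left; exists (inl q).
  - by right; exists (inl q).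
  - by left; exists (inr q).
  - by right; exists (inr q).
have il : injective (both (lshift r : 'I_1 -> _)).
  by move=> [] p [] q // [] /val_inj ->.
have ir : injective (both (@rshift 1 r)).
  by move=> [] p [] q // [] /val_inj ->.
have lr (a : points 1) (b : points r) :
    (both (lshift r) a == both (@rshift 1 r) b) = false.
  by apply/eqP; case: a b => p [] q // [] pq; have := ltn_ord p; rewrite pq.
move=> x y; change (dEs r.+1) with (dcat dE1 (dEs r)).
case: (bE x) (bE y) => -[a ->] [] [b ->].
- by rewrite (same_part_dcat_l dE1 (dEs r)) E1 (inj_eq il).
- by rewrite (same_part_dcat_lr dE1 (dEs r)) lr.
- by rewrite (same_part_dcat_rl dE1 (dEs r)) eq_sym lr.
- by rewrite (same_part_dcat_r dE1 (dEs r)) IH (inj_eq ir).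
Qed.

Lemma dgammas_pperm mu : pperm_diag setT (@sigma_fun mu) (dgammas mu).
Proof.
elim: mu => [|a mu [IHl IHr IHm]]; first by split=> -[].
split=> p q; rewrite ?in_setT /= /dgammas -/dgammas;
  case: (split_ordP p) => p' ->; case: (split_ordP q) => q' ->.
- rewrite (same_part_dcat_l _ _ (inl p') (inl q')) /dgamma same_part_diag_of.
  by rewrite (inj_eq (@ordS_inj _)) eq_lshift.
- by rewrite (same_part_dcat_lr _ _ (inl p') (inl q')) eq_lrshift.
- by rewrite (same_part_dcat_rl _ _ (inl p') (inl q')) eq_rlshift.
- by rewrite (same_part_dcat_r _ _ (inl p') (inl q')) IHl eq_rshift.
- rewrite (same_part_dcat_l _ _ (inr p') (inr q')) /dgamma same_part_diag_of.
  by rewrite eq_lshift.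
- by rewrite (same_part_dcat_lr _ _ (inr p') (inr q')) eq_lrshift.
- by rewrite (same_part_dcat_rl _ _ (inr p') (inr q')) eq_rlshift.
- by rewrite (same_part_dcat_r _ _ (inr p') (inr q')) IHr eq_rshift.
- rewrite (same_part_dcat_l _ _ (inl p') (inr q')) /dgamma same_part_diag_of.
  by rewrite eq_lshift eq_sym.
- by rewrite (same_part_dcat_lr _ _ (inl p') (inr q')) eq_rlshift.
- by rewrite (same_part_dcat_rl _ _ (inl p') (inr q')) eq_lrshift.
- by rewrite (same_part_dcat_r _ _ (inl p') (inr q')) IHm in_setT eq_rshift.
Qed.

Variables (k : nat) (mu : seq nat) (hm : (sumn mu <= k)%N).

Definition sigma_ext_fun (p : 'I_k) : 'I_k :=
  if insub (val p) is Some p' then widen_ord hm (sigma_mu mu p') else p.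

Lemma sigma_ext_fun_widen p :
  sigma_ext_fun (widen_ord hm p) = widen_ord hm (sigma_mu mu p).
Proof. by rewrite /sigma_ext_fun /= valK. Qed.

Lemma sigma_ext_fun_id (p : 'I_k) : (sumn mu <= p)%N -> sigma_ext_fun p = p.
Proof. by move=> mp; rewrite /sigma_ext_fun insubN // -leqNgt. Qed.

Lemma widen_ordP (p : 'I_k) :
  (exists p', p = widen_ord hm p') \/ (sumn mu <= p)%N.
Proof.
case: (ltnP p (sumn mu)) => [pm|]; last by right.
by left; exists (Ordinal pm); apply: val_inj.
Qed.

Lemma widen_ord_injective : injective (widen_ord hm).
Proof. by move=> p q [] /val_inj. Qed.

Lemma sigma_ext_fun_inj : injective sigma_ext_fun.
Proof.
have neq (p' : 'I_(sumn mu)) (q : 'I_k) :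
    (sumn mu <= q)%N -> widen_ord hm p' <> q.
  by move=> mq pq; move: mq; rewrite -pq leqNgt /= ltn_ord.
move=> p q.
case: (widen_ordP p) => [[p' ->]|pm]; case: (widen_ordP q) => [[q' ->]|qm].
- by rewrite !sigma_ext_fun_widen => /widen_ord_injective/perm_inj ->.
- by rewrite sigma_ext_fun_widen (sigma_ext_fun_id qm) => /(neq _ _ qm).
- by rewrite sigma_ext_fun_widen (sigma_ext_fun_id pm) => /esym /(neq _ _ pm).
- by rewrite !sigma_ext_fun_id.
Qed.

Definition sigma_ext : 'S_k := perm sigma_ext_fun_inj.

Lemma sigma_ext_widen p :
  sigma_ext (widen_ord hm p) = widen_ord hm (sigma_mu mu p).
Proof. by rewrite permE sigma_ext_fun_widen. Qed.

Lemma sigma_ext_id (p : 'I_k) :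
  p \notin widen_set hm setT -> sigma_ext p = p.
Proof.
case: (widen_ordP p) => [[p' ->]|mp _]; first by rewrite imset_f.
by rewrite permE sigma_ext_fun_id.
Qed.

Lemma sigma_ext_D (p : 'I_k) :
  (sigma_ext p \in widen_set hm setT) = (p \in widen_set hm setT).
Proof.
case: (widen_ordP p) => [[p' ->]|mp]; last by rewrite permE sigma_ext_fun_id.
by rewrite sigma_ext_widen !imset_f.
Qed.

Lemma mem_widen_set (X : {set 'I_(sumn mu)}) p :
  (widen_ord hm p \in widen_set hm X) = (p \in X).
Proof. by rewrite mem_imset //; apply: widen_ord_injective. Qed.

Lemma widen_setT_ltn (p : 'I_k) : (p \in widen_set hm setT) = (p < sumn mu)%N.
Proof.
apply/imsetP/idP => [[p' _ ->]|pm]; first exact: (ltn_ord p').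
by exists (Ordinal pm) => //; apply: val_inj.
Qed.

Lemma d_mu_pperm : pperm_diag (widen_set hm setT) sigma_ext (d_mu hm).
Proof.
have [gl gr gm] := dgammas_pperm mu.
have castE (p : 'I_k) :
    (exists2 p', p = widen_ord hm p' &
       cast_ord (esym (subnKC hm)) p = lshift _ p') \/
    (exists2 p', (sumn mu <= p)%N &
       cast_ord (esym (subnKC hm)) p = rshift _ p').
  case: (split_ordP (cast_ord (esym (subnKC hm)) p)) => p' pE.
    by left; exists p' => //; apply: val_inj; have := congr1 val pE.
  right; exists p' => //; have /= -> := congr1 val pE.
  exact: leq_addr.
have cE (p q : 'I_k) : (p == q) =
    (cast_ord (esym (subnKC hm)) p == cast_ord (esym (subnKC hm)) q).
  by rewrite (inj_eq (@cast_ord_inj _ _ _)).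
split=> p q; rewrite same_part_drestr /=.
- rewrite cE; case: (castE p) (castE q) => -[p' _ ->] [] [q' _ ->].
  + by rewrite (same_part_dcat_l _ _ (inl p') (inl q')) gl eq_lshift.
  + by rewrite (same_part_dcat_lr _ _ (inl p') (inl q')) eq_lrshift.
  + by rewrite (same_part_dcat_rl _ _ (inl p') (inl q')) eq_rlshift.
  + by rewrite (same_part_dcat_r _ _ (inl p') (inl q')) same_part_dEs eq_rshift.
- rewrite cE; case: (castE p) (castE q) => -[p' _ ->] [] [q' _ ->].
  + by rewrite (same_part_dcat_l _ _ (inr p') (inr q')) gr eq_lshift.
  + by rewrite (same_part_dcat_lr _ _ (inr p') (inr q')) eq_lrshift.
  + by rewrite (same_part_dcat_rl _ _ (inr p') (inr q')) eq_rlshift.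
  + by rewrite (same_part_dcat_r _ _ (inr p') (inr q')) same_part_dEs eq_rshift.
- rewrite widen_setT_ltn.
  case: (castE p) => -[p' pE ->].
    rewrite pE sigma_ext_widen /= (ltn_ord p').
    case: (castE q) => -[q' qE ->].
      rewrite (same_part_dcat_l _ _ (inl p') (inr q')) gm in_setT qE.
      by rewrite (inj_eq widen_ord_injective) permE.
    rewrite (same_part_dcat_lr _ _ (inl p') (inr q')); apply/esym/eqP => qE'.
    by move: qE; rewrite qE' leqNgt /= (ltn_ord (sigma_mu mu p')).
  rewrite ltnNge pE /=.
  case: (castE q) => -[q' _ ->].
    by rewrite (same_part_dcat_rl _ _ (inl p') (inr q')).
  by rewrite (same_part_dcat_r _ _ (inl p') (inr q')) same_part_dEs.
Qed.

End CycleDiagrams.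

(** * Composition with a partial permutation diagram *)

Section BottomPermutation.
Variables (k i : nat) (col : 'I_k -> nat) (ik : (i <= k)%N).
Hypothesis colE : forall a : 'I_i, col (widen_ord ik a) = a.

Lemma bot_perm_lt (s : 'S_i) p (a : 'I_i) :
  col p = a -> bot_perm col s p = widen_ord ik (s^-1%g a).
Proof.
move=> pa; rewrite /bot_perm pa valK; apply: val_inj.
by rewrite val_insubd (leq_trans (ltn_ord _) ik).
Qed.

Lemma bot_perm_ge (s : 'S_i) p : (i <= col p)%N -> bot_perm col s p = p.
Proof. by move=> ip; rewrite /bot_perm insubN // -leqNgt. Qed.

Lemma colour_cases p : (exists a : 'I_i, col p = a) \/ (i <= col p)%N.
Proof.
by case: (ltnP (col p) i) => [pi|]; [left; exists (Ordinal pi) | right].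
Qed.

Lemma bot_permM (s t : 'S_i) p :
  bot_perm col s (bot_perm col t p) = bot_perm col (s * t)%g p.
Proof.
case: (colour_cases p) => [[a pa]|ip]; last by rewrite !bot_perm_ge.
rewrite (bot_perm_lt t pa) (bot_perm_lt (s * t)%g pa).
by rewrite (bot_perm_lt s (colE _)) invMg permM.
Qed.

Lemma dpermM (d : diagram k) (s t : 'S_i) :
  dperm col (dperm col d s) t = dperm col d (s * t)%g.
Proof.
have bM x : on_bottom (bot_perm col s) (on_bottom (bot_perm col t) x) =
    on_bottom (bot_perm col (s * t)%g) x.
  by case: x => //= p; rewrite bot_permM.
by apply: diagP => x y; rewrite !same_part_dperm !bM.
Qed.

(** Even for the identity, [bot_perm] moves a point to the point numbered by
    its colour, which lies in the same part if points of equal colour are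
    joined. *)
Lemma dperm1 (d : diagram k) :
  (forall p q, col p = col q -> same_part d (inr p) (inr q)) ->
  dperm col d (1%g : 'S_i) = d.
Proof.
move=> db.
have b1 x : same_part d (on_bottom (bot_perm col (1%g : 'S_i)) x) x.
  case: x => p /=; first exact: same_part_refl.
  apply: db; case: (colour_cases p) => [[a pa]|ip]; last by rewrite bot_perm_ge.
  by rewrite (bot_perm_lt _ pa) colE pa invg1 perm1.
apply: diagP => x y; rewrite same_part_dperm (same_part_left _ (b1 x)).
by rewrite same_part_sym (same_part_left _ (b1 y)) same_part_sym.
Qed.

Lemma dperm_eq (d d' : diagram k) (s : 'S_i) :
  (forall p q, col p = col q -> same_part d (inr p) (inr q)) ->
  (forall p q, col p = col q -> same_part d' (inr p) (inr q)) ->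
  (dperm col d s == dperm col d' s) = (d == d').
Proof.
move=> db db'; apply/eqP/eqP => [E|-> //].
by rewrite -(dperm1 db) -(dperm1 db') -(mulgV s) -!dpermM E.
Qed.

End BottomPermutation.

Section Composition.
Variables (k : nat) (D : {set 'I_k}) (pi : 'S_k) (d : diagram k).
Hypothesis dP : pperm_diag D pi d.
Hypothesis piD : forall p, (pi p \in D) = (p \in D).

(** A name for the component of [v] when [d] is stacked on [b]: the part of [b]
    that it contains, or its only point if that is an isolated point of the top
    row.  A top point [p] of [D] belongs to the component of the middle point
    [pi p]. *)
Definition vertex_class (b : diagram k) (v : vertex k) :
    {set points k} + 'I_k :=
  match v with
  | inl (inl p) =>
      if p \in D then inl (pblock (dparts b) (inl (pi p))) else inr p
  | inl (inr p) => inl (pblock (dparts b) (inl p))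
  | inr q => inl (pblock (dparts b) (inr q))
  end.

Lemma vertex_class_lower b (x : points k) :
  vertex_class b (lower x) = inl (pblock (dparts b) x).
Proof. by case: x. Qed.

Lemma stack_rel_sym (b : diagram k) : symmetric (stack_rel d b).
Proof.
move=> u v; rewrite /stack_rel; congr (_ || _).
  by apply/existsP/existsP => -[x /existsP[y /and3P[xu yv xy]]];
    exists y; apply/existsP; exists x; rewrite xu yv same_part_sym.
by apply/existsP/existsP => -[x /existsP[y /and3P[xu yv xy]]];
  exists y; apply/existsP; exists x; rewrite xu yv same_part_sym.
Qed.

Lemma stack_rel_upper (b : diagram k) x y :
  same_part d x y -> stack_rel d b (upper x) (upper y).
Proof.
move=> xy; apply/orP; left; apply/existsP; exists x; apply/existsP; exists y.
by rewrite !eqxx.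
Qed.

Lemma stack_rel_lower (b : diagram k) x y :
  same_part b x y -> stack_rel d b (lower x) (lower y).
Proof.
move=> xy; apply/orP; right; apply/existsP; exists x; apply/existsP; exists y.
by rewrite !eqxx.
Qed.

Lemma vertex_class_stack_rel (b : diagram k) u v :
  stack_rel d b u v -> vertex_class b u = vertex_class b v.
Proof.
have [dl dr dm] := dP.
have up (p q : 'I_k) : same_part d (inl p) (inr q) ->
    vertex_class b (upper (inl p)) = vertex_class b (upper (inr q)).
  by rewrite dm /= => /andP[-> /eqP ->].
case/orP => /existsP[x /existsP[y /and3P[/eqP -> /eqP ->]]].
  case: x y => p [] q; rewrite ?dl ?dr.
  - by move/eqP ->.
  - exact: up.
  - by rewrite same_part_sym => /up.
  - by move/eqP ->.
by rewrite -eq_pblock_dparts => /eqP xy; rewrite !vertex_class_lower xy.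
Qed.

Lemma connect_stack_rel (b : diagram k) u v :
  connect (stack_rel d b) u v = (vertex_class b u == vertex_class b v).
Proof.
have [dl dr dm] := dP.
apply/idP/eqP.
  case/connectP => p; elim: p u => [|w p IH] u /=; first by move=> _ ->.
  by case/andP => /vertex_class_stack_rel -> /IH.
have sym := sym_connect_sym (stack_rel_sym b).
have topD p : p \in D ->
    connect (stack_rel d b) (inl (inl p)) (lower (inl (pi p))).
  move=> pD; apply: connect1.
  by apply: (@stack_rel_upper b (inl p) (inr (pi p))); rewrite dm pD /=.
have low w : (exists2 x, vertex_class b w = inl (pblock (dparts b) x) &
                connect (stack_rel d b) w (lower x)) \/
             (exists p, w = inl (inl p) /\ vertex_class b w = inr p).
  case: w => [[]|] p /=.
  - case: ifP => pD; last by right; exists p.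
    by left; exists (inl (pi p)); last exact: topD.
  - by left; exists (inl p).
  - by left; exists (inr p).
case: (low u) => [[x -> ux]|[p [-> ->]]];
  case: (low v) => [[y -> vy]|[q [-> ->]]] //.
  case=> /eqP; rewrite eq_pblock_dparts => xy.
  apply: connect_trans ux _; rewrite sym; apply: connect_trans vy _.
  by rewrite sym; apply: connect1; apply: stack_rel_lower.
by case=> ->.
Qed.

Lemma component_class (b : diagram k) u :
  component d b u = [set v | vertex_class b u == vertex_class b v].
Proof. by apply/setP => v; rewrite !inE connect_stack_rel. Qed.

Lemma same_part_dcomp (b : diagram k) x y :
  same_part (dcomp d b) x y =
  (vertex_class b (outer x) == vertex_class b (outer y)).
Proof.
rewrite same_part_diag_of !component_class.
apply/eqP/eqP => [/setP/(_ (outer y))|->] //.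
by rewrite !inE eqxx => /eqP.
Qed.

Lemma same_part_dcomp_top (b : diagram k) p q :
  p \in D -> q \in D ->
  same_part (dcomp d b) (inl p) (inl q) = same_part b (inl (pi p)) (inl (pi q)).
Proof.
move=> pD qD; by rewrite same_part_dcomp /= pD qD -eq_pblock_dparts.
Qed.

Lemma same_part_dcomp_isolated (b : diagram k) p x :
  p \notin D -> same_part (dcomp d b) (inl p) x = (inl p == x).
Proof.
move=> /[dup] pD /negPf pD'; rewrite same_part_dcomp /= pD'.
case: x => q /=; last by apply/eqP/eqP.
case: ifP => qD; last by apply/eqP/eqP => -[->].
by apply/eqP/eqP => // -[pq]; rewrite pq qD in pD.
Qed.

Lemma same_part_dcomp_through (b : diagram k) p q :
  same_part (dcomp d b) (inl p) (inr q) =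
  (p \in D) && same_part b (inl (pi p)) (inr q).
Proof.
by rewrite same_part_dcomp /= -eq_pblock_dparts; case: ifP.
Qed.

Lemma same_part_dcomp_bottom (b : diagram k) p q :
  same_part (dcomp d b) (inr p) (inr q) = same_part b (inr p) (inr q).
Proof.
by rewrite same_part_dcomp /= -eq_pblock_dparts.
Qed.

Definition vertex_bottom (f : 'I_k -> 'I_k) (v : vertex k) : vertex k :=
  match v with inl w => inl w | inr q => inr (f q) end.

Lemma vertex_class_dperm i (col : 'I_k -> nat) (s : 'S_i) (b : diagram k) u v :
  let rho := vertex_bottom (bot_perm col s) in
  (vertex_class (dperm col b s) u == vertex_class (dperm col b s) v) =
  (vertex_class b (rho u) == vertex_class b (rho v)).
Proof.
have inlE (c : diagram k) x y : (inl (pblock (dparts c) x) ==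
    inl (pblock (dparts c) y) :> {set points k} + 'I_k) = same_part c x y.
  by rewrite -eq_pblock_dparts.
by case: u v => [[]|] p [[]|] q /=; do ?case: ifP => _ //;
  rewrite !inlE same_part_dperm.
Qed.

Lemma dcomp_dperm i (col : 'I_k -> nat) (s : 'S_i) (b : diagram k) :
  dcomp d (dperm col b s) = dperm col (dcomp d b) s.
Proof.
apply: diagP => x y.
rewrite same_part_dperm !same_part_dcomp vertex_class_dperm.
by case: x y => p [] q.
Qed.

(** A middle point of [D] is joined to the top row, whereas a middle point
    outside [D], isolated in both diagrams, is a component of its own. *)
Lemma ncomp_isolated (b : diagram k) :
  (forall y x, y \notin D -> same_part b (inl y) x -> x = inl y) ->
  ncomp d b = #|~: D|.
Proof.
move=> iso.
have inj : injective (fun y : 'I_k => [set inl (inr y)] : {set vertex k}).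
  by move=> y z /set1_inj [->].
rewrite /ncomp -(card_imset (mem (~: D)) inj); apply: eq_card => B.
have comp y : y \notin D -> component d b (inl (inr y)) = [set inl (inr y)].
  move=> yD; rewrite component_class; apply/setP => v; rewrite !inE /=.
  apply/eqP/eqP => [|-> //].
  case: v => [[]|] q /=; [case: ifP => // qD|..] => -[] /eqP;
    rewrite eq_pblock_dparts => /iso => /(_ yD) // [] qy.
    by move: yD; rewrite -qy piD qD.
  by rewrite qy.
rewrite inE; apply/andP/imsetP => [[/imsetP[u _ ->] um]|[y yD ->]].
  have : u \in component d b u by rewrite inE connect0.
  move=> /(subsetP um) /imsetP[y _ uy]; subst u.
  have yD : y \notin D.
    apply/negP => yD.
    have : inl (inl ((pi^-1)%g y)) \in component d b (inl (inr y)).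
      by rewrite component_class inE /= -piD permKV yD.
    by move=> /(subsetP um) /imsetP[].
  by exists y; rewrite ?inE ?comp.
rewrite inE in yD; rewrite -(comp _ yD); split; first exact: imset_f.
by rewrite comp // sub1set; apply: imset_f.
Qed.

(** Permuting the bottom row permutes the components and fixes those contained
    in the middle row. *)
Lemma ncomp_dperm i (ik : (i <= k)%N) (s : 'S_i) (b : diagram k) :
  ncomp d (dperm val b s) = ncomp d b.
Proof.
have valE (a : 'I_i) : val (widen_ord ik a) = a by [].
pose rho := vertex_bottom (bot_perm val s).
have rho_mid v : (rho v \in middle k) || (v \in middle k) -> rho v = v.
  by case: v => [[]|] q //= /orP[] /imsetP[].
have rhoK v : exists v', rho v' = v.
  case: v => [w|q]; first by exists (inl w).
  exists (inr (bot_perm val s^-1%g q)); rewrite /= (bot_permM valE) mulgV.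
  congr inr; case: (colour_cases i val q) => [[a qa]|qi]; last first.
    by rewrite bot_perm_ge.
  by rewrite (bot_perm_lt ik _ qa) invg1 perm1; apply: val_inj.
have compE u v :
    (v \in component d (dperm val b s) u) = (rho v \in component d b (rho u)).
  by rewrite !component_class !inE vertex_class_dperm.
have rho_id v : v \in middle k -> rho v = v.
  by move=> vm; apply: rho_mid; rewrite vm orbT.
have mem_comp (c : diagram k) u : u \in component d c u by rewrite inE connect0.
move: (mem_comp b) (mem_comp (dperm val b s)) compE; rewrite /ncomp.
(* Only the relation between the two families of components is used below. *)
move: (component d b) (component d (dperm val b s)) => c c' uc uc' c'E.
have cm u : u \in middle k ->
    (c u \subset middle k) || (c' u \subset middle k) -> c' u = c u.
  move=> um; have := c'E u; rewrite (rho_id u um) => uE.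
  case/orP => Bm; apply/setP => v; apply/idP/idP => vB.
  - have vm := subsetP Bm (rho v); rewrite -uE in vm.
    by rewrite uE in vB *; rewrite -(rho_mid v) ?(subsetP Bm _ vB).
  - by rewrite uE rho_id // (subsetP Bm).
  - by rewrite -(rho_id v) ?(subsetP Bm) // -uE.
  - case: (rhoK v) vB => v' <-; rewrite -uE => v'B.
    by rewrite rho_id // (subsetP Bm).
congr #|pred_of_set _|; apply/setP => B; rewrite !inE.
apply/andP/andP => -[/imsetP[u _ ->] Bm].
  have um : u \in middle k by apply: (subsetP Bm).
  rewrite Bm; split=> //; apply/imsetP; exists u => //.
  by rewrite cm // Bm orbT.
have um : u \in middle k by apply: (subsetP Bm).
rewrite Bm; split=> //; apply/imsetP; exists u => //.
by rewrite cm // Bm.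
Qed.

End Composition.

(** * The diagram bases of standard modules *)

Section Rank.
Variables (k : nat) (d : diagram k).

Lemma propagating_pblockP x :
  reflect ((exists r, same_part d x (inl r)) /\
           (exists q, same_part d x (inr q)))
          (propagating (pblock (dparts d) x)).
Proof.
apply: (iffP andP) => [[/existsP ? /existsP ?]|[? ?]]; first by split.
by split; apply/existsP.
Qed.

(** The parts of the [phi a] are [j] distinct propagating parts, so the rank is
    [j] exactly when there is no other one. *)
Lemma rankP j (phi : 'I_j -> 'I_k) :
  (forall a b, same_part d (inr (phi a)) (inr (phi b)) -> a = b) ->
  (forall a, exists r, same_part d (inl r) (inr (phi a))) ->
  reflect (forall r q, same_part d (inl r) (inr q) ->
             exists a, same_part d (inr q) (inr (phi a)))
          (rank d == j).
Proof.
move=> phi_inj phi_prop.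
pose M := [set pblock (dparts d) (inr (phi a)) | a : 'I_j].
have cM : #|M| = j.
  rewrite card_imset ?card_ord // => a b /eqP.
  by rewrite eq_pblock_dparts => /phi_inj.
have sM : M \subset [set B in dparts d | propagating B].
  apply/subsetP => _ /imsetP[a _ ->]; rewrite inE pblock_dparts_mem /=.
  apply/propagating_pblockP; split; last first.
    by exists (phi a); apply: same_part_refl.
  by have [r ra] := phi_prop a; exists r; rewrite same_part_sym.
have -> : (rank d == j) = ([set B in dparts d | propagating B] \subset M).
  rewrite -{1}cM /rank eq_sym; apply/eqP/idP => [cE|sM'].
    by have /eqP <- : M == [set B in dparts d | propagating B] by
      rewrite eqEcard sM cE leqnn.
  by congr #|pred_of_set _|; apply/eqP; rewrite eqEsubset sM.
apply: (iffP subsetP) => [H r q rq|H B].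
  have /H/imsetP[a _ /eqP] : pblock (dparts d) (inr q) \in
      [set B in dparts d | propagating B].
    rewrite inE pblock_dparts_mem; apply/propagating_pblockP; split.
      by exists r; rewrite same_part_sym.
    by exists q; apply: same_part_refl.
  by rewrite eq_pblock_dparts; exists a.
rewrite inE => /andP[/dparts_pblock[x _ ->]].
case/propagating_pblockP => -[r xr] [q xq].
have [|a qa] := H r q; first by rewrite -(same_part_left _ xr).
apply/imsetP; exists a => //; apply/eqP; rewrite eq_pblock_dparts.
exact: same_part_trans xq qa.
Qed.

End Rank.

Section StandardBasis.
Variables (k j : nat) (jk : (j <= k)%N).
Implicit Types (d : diagram k) (b : Vki k j).

(** The condition on the rank becomes the condition that only the first [j]
    bottom points are joined to the top row. *)
Lemma in_VP d :
  reflect [/\ forall p q, same_part d (inr p) (inr q) -> p = q,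
              forall a, exists r, same_part d (inl r) (inr (widen_ord jk a)) &
              forall r q, same_part d (inl r) (inr q) -> (q < j)%N]
          (in_V j d).
Proof.
have H1 : (forall p q, same_part d (inr p) (inr q) -> p = q) ->
    forall a a',
      same_part d (inr (widen_ord jk a)) (inr (widen_ord jk a')) -> a = a'.
  by move=> sing a a' /sing [] /val_inj.
apply: (iffP and3P) => [[rj /forallP sing /forallP prop]|[sing lab low]].
  have sing' p q : same_part d (inr p) (inr q) -> p = q.
    by move=> pq; have /forallP/(_ q) := sing p; rewrite pq => /eqP.
  have lab a : exists r, same_part d (inl r) (inr (widen_ord jk a)).
    have := prop (widen_ord jk a); rewrite (ltn_ord a) => /propagating_pblockP.
    by case=> -[r ra] _; exists r; rewrite same_part_sym.
  split=> // r q rq; move/(rankP (H1 sing') lab): rj => /(_ _ _ rq) [a].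
  by move/sing' => ->; exact: (ltn_ord a).
split.
- apply/(rankP (H1 sing) lab) => r q /low qj; exists (Ordinal qj).
  by have <- : q = widen_ord jk (Ordinal qj) by [apply: val_inj];
    apply: same_part_refl.
- by apply/forallP => p; apply/forallP => q; apply/implyP => /sing ->.
apply/forallP => p; apply/implyP => pj; apply/propagating_pblockP; split.
  have [r rp] := lab (Ordinal pj); exists r; rewrite same_part_sym.
  by have <- : widen_ord jk (Ordinal pj) = p by apply: val_inj.
by exists p; apply: same_part_refl.
Qed.

Let valE (a : 'I_j) : val (widen_ord jk a) = a. Proof. by []. Qed.

Lemma bot_perm_val1 (p : 'I_k) : bot_perm val (1%g : 'S_j) p = p.
Proof.
case: (colour_cases j val p) => [[a pa]|jp]; last by rewrite bot_perm_ge.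
by rewrite (bot_perm_lt jk _ pa) invg1 perm1; apply: val_inj.
Qed.

Lemma bot_perm_valK (s : 'S_j) :
  cancel (@bot_perm k j val s) (bot_perm val s^-1%g).
Proof. by move=> p; rewrite (bot_permM valE) mulVg bot_perm_val1. Qed.

Lemma in_V_dperm d (s : 'S_j) : in_V j d -> in_V j (dperm val d s).
Proof.
case/in_VP => sing lab low; apply/in_VP; split.
- move=> p q; rewrite same_part_dperm => /sing.
  exact: (can_inj (bot_perm_valK s)).
- move=> a; have [r ra] := lab (s^-1%g a); exists r.
  by rewrite same_part_dperm /= (bot_perm_lt jk s (valE a)).
- move=> r q; rewrite same_part_dperm /= => /low.
  by case: (ltnP q j) => // jq; rewrite bot_perm_ge // ltnNge jq.
Qed.

Lemma val_V_ract b (s : 'S_j) : val (V_ract b s) = dperm val (val b) s.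
Proof. by rewrite val_insubd in_V_dperm ?(valP b). Qed.

Lemma V_ract1 b : V_ract b 1%g = b.
Proof.
apply: val_inj; rewrite val_V_ract (dperm1 valE) // => p q /val_inj ->.
exact: same_part_refl.
Qed.

Lemma V_ractM b s t : V_ract (V_ract b s) t = V_ract b (s * t)%g.
Proof.
apply/val_inj/(etrans (val_V_ract (V_ract b s) t)).
apply/(etrans (congr1 (fun d => dperm val d t) (val_V_ract b s))).
exact/(etrans (dpermM valE _ _ _))/esym/val_V_ract.
Qed.

End StandardBasis.

Section DualSymmetricInverseBasis.
Variables (t j : nat) (jt : (j <= t)%N).
Implicit Types (d : diagram t) (b : Lti t j).

Lemma Lcol_lt (p : 'I_t) : (0 < j)%N -> (Lcol j p < j)%N.
Proof.
move=> j0; rewrite /Lcol gtn_min orbC.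
by case: (j) j0 => //= n _; rewrite leqnn.
Qed.

Lemma Lcol_widen (a : 'I_j) : Lcol j (widen_ord jt a) = a.
Proof. by apply/minn_idPl => /=; case: (j) a => [[]|n] // a; rewrite -ltnS. Qed.

(** If [j > 0], the bottom row has [j] parts, so that the rank is [j] as soon as
    all parts are propagating.  If [j = 0], any point would create a propagating
    part, whence the last condition. *)
Lemma in_LP d :
  reflect [/\ forall p q, same_part d (inr p) (inr q) = (Lcol j p == Lcol j q),
              forall q, exists r, same_part d (inl r) (inr q),
              forall r, exists q, same_part d (inl r) (inr q) &
              (0 < t)%N -> (0 < j)%N]
          (in_L j d).
Proof.
have Linj :
    (forall p q, same_part d (inr p) (inr q) = (Lcol j p == Lcol j q)) ->
    forall a a',
      same_part d (inr (widen_ord jt a)) (inr (widen_ord jt a')) -> a = a'.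
  by move=> bot a a'; rewrite bot !Lcol_widen => /eqP /val_inj.
apply: (iffP and3P) => [[/forall_inP allp rj bot]|[bot top low tj]].
  have prop x : propagating (pblock (dparts d) x).
    exact/allp/pblock_dparts_mem.
  split=> [p q|q|r|t0].
  - by have /forallP/(_ p)/forallP/(_ q)/eqP := bot.
  - have /propagating_pblockP[[r rq] _] := prop (inr q).
    by exists r; rewrite same_part_sym.
  - by have /propagating_pblockP[_] := prop (inl r).
  rewrite -(eqP rj) /rank card_gt0; apply/set0Pn.
  exists (pblock (dparts d) (inl (Ordinal t0))).
  by rewrite inE pblock_dparts_mem prop.
split; last by apply/forallP => p; apply/forallP => q; rewrite bot.
  apply/forall_inP => B /dparts_pblock[x _ ->]; apply/propagating_pblockP.
  case: x => p.
    by split; [exists p; apply: same_part_refl | apply: low].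
  split; last by exists p; apply: same_part_refl.
  by have [r rp] := top p; exists r; rewrite same_part_sym.
apply/(rankP (Linj bot) (fun a => top _)) => r q _.
have j0 : (0 < j)%N by apply/tj/(leq_ltn_trans _ (ltn_ord r)).
exists (Ordinal (Lcol_lt q j0)).
by rewrite bot Lcol_widen.
Qed.

Lemma in_L_dperm d (s : 'S_j) : in_L j d -> in_L j (dperm (Lcol j) d s).
Proof.
case/in_LP => bot top low tj; apply/in_LP.
have j0 : 'I_t -> (0 < j)%N by move=> p; apply/tj/(leq_ltn_trans _ (ltn_ord p)).
have colE (p : 'I_t) : exists a : 'I_j, Lcol j p = a.
  by exists (Ordinal (Lcol_lt p (j0 p))).
split=> //.
- move=> p q; rewrite same_part_dperm bot.
  have [[a pa] [a' qb]] := (colE p, colE q).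
  rewrite (bot_perm_lt jt s pa) (bot_perm_lt jt s qb) !Lcol_widen pa qb.
  by rewrite !(inj_eq (@ord_inj _)) (inj_eq perm_inj).
- move=> q; have [r rq] := top (bot_perm (Lcol j) s q); exists r.
  by rewrite same_part_dperm.
- move=> r; have [q rq] := low r; have [a qa] := colE q.
  exists (widen_ord jt (s a)); rewrite same_part_dperm /=.
  rewrite (bot_perm_lt jt s (Lcol_widen _)) permK.
  by apply: same_part_trans rq _; rewrite bot qa Lcol_widen.
Qed.

Lemma val_L_ract b (s : 'S_j) : val (L_ract b s) = dperm (Lcol j) (val b) s.
Proof. by rewrite val_insubd in_L_dperm ?(valP b). Qed.

Lemma L_ract1 b : L_ract b 1%g = b.
Proof.
apply: val_inj; rewrite val_L_ract (dperm1 Lcol_widen) // => p q pq.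
by case/in_LP: (valP b) => -> _ _ _; rewrite pq.
Qed.

Lemma L_ractM b s u : L_ract (L_ract b s) u = L_ract b (s * u)%g.
Proof.
apply/val_inj/(etrans (val_L_ract (L_ract b s) u)).
apply/(etrans (congr1 (fun d => dperm (Lcol j) d u) (val_L_ract b s))).
exact/(etrans (dpermM Lcol_widen _ _ _))/esym/val_L_ract.
Qed.

End DualSymmetricInverseBasis.

(** * Characters of partial permutation diagrams *)

Lemma pmul_dbasisE (C : fieldType) (k : nat) (delta : C) (d b : diagram k) :
  pmul delta (dbasis C d) (dbasis C b) = dmul delta d b.
Proof.
rewrite /pmul; move: (dmul delta) => F.
have dE (d' e : diagram k) : dbasis C d' e = (e == d')%:R by rewrite ffunE.
(* Comparing two elements of the basis by unfolding them would enumerate all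
   set-partitions. *)
move: (dbasis C) dE => basis dE.
rewrite (bigD1 d) // [X in _ + X = _]big1 => [|d' d'd]; last first.
  by apply: big1 => b' _; rewrite !dE (negPf d'd) mul0r scale0r.
rewrite addr0 (bigD1 b) // [X in _ + X = _]big1 => [|b' b'b]; last first.
  by rewrite !dE (negPf b'b) mulr0 scale0r.
by rewrite addr0 !dE !eqxx mul1r scale1r.
Qed.

Lemma pmul_dbasis (C : fieldType) (k : nat) (delta : C) (d b e : diagram k) :
  pmul delta (dbasis C d) (dbasis C b) e =
  delta ^+ ncomp d b * (dcomp d b == e)%:R.
Proof. by rewrite pmul_dbasisE ffunE ffunE eq_sym. Qed.

Lemma sum_indicator (C : fieldType) (T : finType) (P : pred T) (c : C) :
  \sum_b c * (P b)%:R = c * #|[set b | P b]|%:R.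
Proof.
rewrite -mulr_sumr -natr_sum -sum1_card big_mkcond [in RHS]big_mkcond.
by congr (_ * _%:R); apply: eq_bigr => b _; rewrite inE; case: (P b).
Qed.

Section Characters.
Variables (C : fieldType) (delta : C) (j : nat) (la : seq nat).
Hypothesis fact_neq0 : j`!%:R != 0 :> C.

Section StandardCharacter.
Variables (k : nat) (D : {set 'I_k}) (pi : 'S_k) (d : diagram k).
Hypothesis jk : (j <= k)%N.
Hypothesis dP : pperm_diag D pi d.
Hypothesis piD : forall p, (pi p \in D) = (p \in D).

(** A point outside [D] is isolated in [d o b], and the action on the bottom row
    does not affect the connections of the top row among themselves nor whether
    a top point reaches the bottom row. *)
Lemma fixed_isolated (b : diagram k) (s : 'S_j) :
  dcomp d b = dperm val b s ->
  forall y x, y \notin D -> same_part b (inl y) x -> x = inl y.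
Proof.
move=> fixb y x yD.
have bE z : same_part b (inl y) (on_bottom (bot_perm val s) z) = (inl y == z).
  by rewrite -(same_part_dcomp_isolated dP b z yD) fixb same_part_dperm.
case: x => [p|q]; first by rewrite (bE (inl p)) => /eqP.
by rewrite -[q](bot_perm_valK jk s^-1%g) invgK (bE (inr _)).
Qed.

(** Only the diagrams with [d o b = b.s] contribute, and for them the number of
    removed components does not depend on [b]. *)
Lemma chi_P_pperm :
  chi_P j delta la (dbasis C d) =
  j`!%:R^-1 * \sum_(s : 'S_j) vtrace (@specht_act C j la s) *
    (delta ^+ #|~: D| *
     #|[set b : Vki k j | dcomp d (val b) == val (V_ract b s)]|%:R).
Proof.
pose g := V_lact delta (dbasis C d) : Vki k j -> _.
have gE b b' :
    g b b' = delta ^+ ncomp d (val b) * (dcomp d (val b) == val b')%:R.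
  by rewrite ffunE pmul_dbasis.
rewrite /chi_P /Pmod_act (vtrace_tens_map (V_ract1 jk) (V_ractM jk)
  (@specht_act_linear _ _ _) (@specht_actM _ _ _)) //.
  congr (_ * _); apply: eq_bigr => s _; congr (_ * _).
  rewrite -sum_indicator; apply: eq_bigr => b _; rewrite -/g gE.
  case: eqP => fixb; last by rewrite !mulr0.
  rewrite (val_V_ract jk) in fixb.
  by rewrite (ncomp_isolated dP piD) //; apply: fixed_isolated fixb.
move=> b b' s; apply: (etrans (gE _ _)); apply/esym/(etrans (gE _ _))/esym.
suff E (e e' : diagram k) : e = dperm val (val b) s ->
    e' = dperm val (val b') s ->
    delta ^+ ncomp d e * (dcomp d e == e')%:R =
    delta ^+ ncomp d (val b) * (dcomp d (val b) == val b')%:R :> C.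
  by apply: E; apply: val_V_ract.
move=> -> ->; rewrite (ncomp_dperm dP jk) (dcomp_dperm dP).
by rewrite (dperm_eq (fun=> erefl : val (widen_ord jk _) = _)) // => p q;
  move/val_inj ->; apply: same_part_refl.
Qed.

End StandardCharacter.

Lemma chi_Istar_pperm t (pi : 'S_t) (d : diagram t) (c : C)
    (u : {ffun Istar t -> C^o}) :
  (j <= t)%N -> pperm_diag setT pi d ->
  (forall e, u e = c * (d == val e)%:R) ->
  chi_Istar j la u =
  j`!%:R^-1 * \sum_(s : 'S_j) vtrace (@specht_act C j la s) *
    (c * #|[set b : Lti t j | dcomp d (val b) == val (L_ract b s)]|%:R).
Proof.
move=> jt dP uE.
have allp : all_propagating d.
  have [_ _ dm] := dP.
  apply/forall_inP => B /dparts_pblock[x _ ->]; apply/propagating_pblockP.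
  case: x => p; split.
  - by exists p; apply: same_part_refl.
  - by exists (pi p); rewrite dm in_setT /=.
  - by exists (pi^-1%g p); rewrite same_part_sym dm in_setT permKV /=.
  - by exists p; apply: same_part_refl.
pose g : Lti t j -> _ := L_lact u.
have gE b b' : g b b' = c * (dcomp d (val b) == val b')%:R.
  rewrite ffunE big_mkcond (bigD1 (Sub d allp : Istar t)) //= uE eqxx mulr1.
  rewrite big1 ?addr0 => [|e]; first by case: ifP; rewrite ?mulr1 ?mulr0.
  rewrite -val_eqE /= eq_sym uE => /negPf ->.
  by rewrite mulr0; case: ifP.
have bot (b : Lti t j) p q :
    Lcol j p = Lcol j q -> same_part (val b) (inr p) (inr q).
  by case/(in_LP jt): (valP b) => -> _ _ _ ->.
rewrite /chi_Istar /Imod_act (vtrace_tens_map (L_ract1 jt) (L_ractM jt)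
  (@specht_act_linear _ _ _) (@specht_actM _ _ _)) //.
  congr (_ * _); apply: eq_bigr => s _; congr (_ * _).
  by rewrite -sum_indicator; apply: eq_bigr => b _; rewrite -/g gE.
move=> b b' s; apply: (etrans (gE _ _)); apply/esym/(etrans (gE _ _))/esym.
suff E (e e' : diagram t) : e = dperm (Lcol j) (val b) s ->
    e' = dperm (Lcol j) (val b') s ->
    c * (dcomp d e == e')%:R = c * (dcomp d (val b) == val b')%:R :> C.
  by apply: E; apply: val_L_ract.
move=> -> ->; rewrite (dcomp_dperm dP).
rewrite (dperm_eq (@Lcol_widen t j jt)) // => p q pq; last exact: bot.
by rewrite (same_part_dcomp_bottom dP) bot.
Qed.

End Characters.

(** * Counting fixed diagrams by labelings *)

Section OnTop.
Variables (k : nat) (D : {set 'I_k}) (pi : 'S_k) (d : diagram k).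
Hypothesis dP : pperm_diag D pi d.
Hypothesis pi_id : forall p, p \notin D -> pi p = p.

Definition on_top (A : Type) (f : A -> A) (x : A + A) : A + A :=
  match x with inl p => inl (f p) | inr q => inr q end.

(** When [b] isolates the points outside [D], composing it with [d] amounts to
    relabelling its top row along [pi]. *)
Lemma same_part_dcomp_on_top (b : diagram k) x y :
  (forall y x, y \notin D -> same_part b (inl y) x -> x = inl y) ->
  same_part (dcomp d b) x y = same_part b (on_top pi x) (on_top pi y).
Proof.
move=> iso.
have isoE p z : p \notin D -> same_part b (inl p) z = (inl p == z).
  by move=> pD; apply/idP/eqP => [/(iso _ _ pD) //|<-]; apply: same_part_refl.
have top_id p z : p \notin D ->
    (inl p == z) = same_part b (on_top pi (inl p)) (on_top pi z).
  move=> pD; rewrite /= (pi_id pD) isoE // -{2}(pi_id pD).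
  by case: z => q //=; apply/eqP/eqP => [[->]|[/perm_inj ->]].
case: x y => p [] q.
- case: (boolP (p \in D)) => pD.
    case: (boolP (q \in D)) => qD; first by rewrite (same_part_dcomp_top dP).
    rewrite same_part_sym (same_part_dcomp_isolated dP) // top_id //.
    exact: same_part_sym.
  by rewrite (same_part_dcomp_isolated dP) // top_id.
- case: (boolP (p \in D)) => pD.
    by rewrite (same_part_dcomp_through dP) pD.
  by rewrite (same_part_dcomp_isolated dP) // top_id.
- rewrite same_part_sym [RHS]same_part_sym.
  case: (boolP (q \in D)) => qD.
    by rewrite (same_part_dcomp_through dP) qD.
  by rewrite (same_part_dcomp_isolated dP) // top_id.
- exact: (same_part_dcomp_bottom dP).
Qed.

End OnTop.

Section Labelings.
Variables (m j : nat) (sigma : 'S_m).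

(** [c p = Some a] when the part of [p] contains the bottom point (or the bottom
    part) number [a], and [c p = None] when it contains none of those. *)
Definition labeling : finType := {ffun 'I_m -> option 'I_j}.

Definition unlabelled (c : labeling) : {set 'I_m} := [set p | c p == None].

Definition labeling_onto (c : labeling) : bool :=
  [forall a, exists p, c p == Some a].

Definition equivariant (s : 'S_j) (c : labeling) : bool :=
  [forall p, c (sigma p) == omap s (c p)].

Lemma equivariantP (s : 'S_j) (c : labeling) :
  reflect (forall p a, (c (sigma p) == Some a) = (c p == Some (s^-1%g a)))
          (equivariant s c).
Proof.
apply: (iffP forallP) => [H p a|H p].
  rewrite (eqP (H p)); case: (c p) => [b|] //=.
  by apply/eqP/eqP => [[<-]|[->]]; rewrite ?permK ?permKV.
case E: (c p) => [b|] /=; first by rewrite H permK E.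
case E': (c (sigma p)) => [a|] //.
by have := H p a; rewrite E E' eqxx.
Qed.

Lemma equivariant_unlabelled (s : 'S_j) (c : labeling) p :
  equivariant s c -> (sigma p \in unlabelled c) = (p \in unlabelled c).
Proof. by move=> /forallP/(_ p)/eqP cE; rewrite !inE cE; case: (c p). Qed.

Lemma card_labelled (c : labeling) :
  labeling_onto c -> (j <= #|~: unlabelled c|)%N.
Proof.
move=> /forallP onto.
pose u a := xchoose (existsP (onto a)).
have uE a : c (u a) = Some a by apply/eqP/(xchooseP (existsP (onto a))).
have u_inj : injective u.
  by move=> a a' uaa; have := uE a; rewrite uaa uE => -[].
rewrite -[j]card_ord -(card_imset predT u_inj) subset_leq_card //.
by apply/subsetP => _ /imsetP[a _ ->]; rewrite !inE uE.
Qed.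

End Labelings.

Section FixedPartition.
Variables (m : nat) (sigma : 'S_m) (N : {set 'I_m}) (xi : {set {set 'I_m}}).
Hypothesis xiN : partition xi N.

Let triv : trivIset xi. Proof. by case/and3P: xiN. Qed.

Let memN p : (p \in cover xi) = (p \in N).
Proof. by rewrite (cover_partition xiN). Qed.

Lemma mem_pblock_eq p q :
  p \in N -> q \in N -> (q \in pblock xi p) = (pblock xi p == pblock xi q).
Proof. by move=> pN qN; rewrite eq_pblock ?memN. Qed.

Lemma pblock_fixed p :
  [set sigma @: (K : {set _}) | K in xi] = xi -> p \in N ->
  pblock xi (sigma p) = sigma @: pblock xi p.
Proof.
move=> fix_xi pN; apply: (def_pblock triv); last first.
  by rewrite imset_f // mem_pblock memN.
by rewrite -{2}fix_xi imset_f // pblock_mem ?memN.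
Qed.

(** Under this invariance [sigma] maps the block of [p] onto the block of
    [sigma p]; having as many blocks as [xi], its image is [xi]. *)
Lemma fixed_partition :
  (forall p, (sigma p \in N) = (p \in N)) ->
  (forall p q, p \in N -> q \in N ->
     (pblock xi (sigma p) == pblock xi (sigma q)) =
     (pblock xi p == pblock xi q)) ->
  [set sigma @: (K : {set _}) | K in xi] = xi.
Proof.
move=> sigmaN H; apply/eqP.
rewrite eqEcard card_imset ?leqnn ?andbT; last first.
  by apply: imset_inj; apply: perm_inj.
apply/subsetP => _ /imsetP[K Kxi ->].
have /and3P[_ _ n0] := xiN.
have /set0Pn[p pK] : K != set0 by apply: contraNneq n0 => <-.
have pN : p \in N by rewrite -memN; apply/bigcupP; exists K.
have sub r q : r \in N -> q \in pblock xi r -> q \in N.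
  move=> rN qr; rewrite -memN; apply/bigcupP.
  by exists (pblock xi r); rewrite ?pblock_mem ?memN.
have spN : sigma p \in N by rewrite sigmaN.
suff -> : sigma @: K = pblock xi (sigma p) by rewrite pblock_mem ?memN.
rewrite -(def_pblock triv Kxi pK); apply/setP => q.
rewrite -[q](permKV sigma) mem_imset; last exact: perm_inj.
move: (sigma^-1%g q) => r; apply/idP/idP => rp.
  have rN := sub _ _ pN rp; rewrite mem_pblock_eq // in rp.
  by rewrite mem_pblock_eq ?sigmaN ?H.
have := sub _ _ spN rp; rewrite sigmaN => rN.
rewrite mem_pblock_eq ?sigmaN // H // in rp.
by rewrite mem_pblock_eq.
Qed.

End FixedPartition.

Section CountL.
Variables (m t j : nat) (X : {set 'I_m}) (sigma : 'S_m).
Variables (z : 'I_t -> 'I_m) (tau : 'S_t) (d : diagram t).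
Hypothesis z_inj : injective z.
Hypothesis zP : forall p, reflect (exists r, z r = p) (p \notin X).
Hypothesis sigmaX : forall p, (sigma p \in X) = (p \in X).
Hypothesis tauE : forall r, z (tau r) = sigma (z r).
Hypothesis dP : pperm_diag setT tau d.
Hypothesis jt : (j <= t)%N.

Let domP p : p \in X \/ exists r, p = z r.
Proof.
by case: (boolP (p \in X)) => [|/zP[r <-]]; [left | right; exists r].
Qed.

Let zX r : z r \notin X. Proof. by apply/zP; exists r. Qed.

(** The parts of a diagram of [L(t,j)] are the fibres of [L_code c], where [c]
    is its labeling. *)
Definition L_code (c : labeling m j) (x : points t) : option 'I_j :=
  match x with inl r => c (z r) | inr q => insub (Lcol j q) end.

Definition L_label (b : diagram t) : labeling m j :=
  [ffun p => if [pick r | z r == p] is Some r then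
               [pick a | same_part b (inl r) (inr (widen_ord jt a))]
             else None].

Let insub_Lcol (q : 'I_t) : (0 < j)%N ->
  exists2 a : 'I_j, insub (Lcol j q) = Some a & Lcol j q = a.
Proof.
move=> j0; pose a : 'I_j := Ordinal (Lcol_lt q j0).
by exists a => //; apply: (valK a).
Qed.

Let insub_Lcol_widen (a : 'I_j) : insub (Lcol j (widen_ord jt a)) = Some a.
Proof. by rewrite Lcol_widen valK. Qed.

Let Lcol_insub (p q : 'I_t) : (0 < j)%N ->
  (Lcol j p == Lcol j q) =
  (insub (Lcol j p) == insub (Lcol j q) :> option 'I_j).
Proof.
move=> j0; have [a -> ->] := insub_Lcol p j0.
have [a' -> ->] := insub_Lcol q j0.
by apply/eqP/eqP => [/ord_inj ->|[->]].
Qed.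

Lemma L_label_X b p : p \in X -> L_label b p = None.
Proof.
move=> pX; rewrite ffunE; case: pickP => // r /eqP rp.
by move: (zX r); rewrite rp pX.
Qed.

Section LabelOfDiagram.
Variable b : diagram t.
Hypothesis bL : in_L j b.

Let j_gt0 : 'I_t -> (0 < j)%N.
Proof.
by case/(in_LP jt): bL => _ _ _ tj r; apply/tj/(leq_ltn_trans _ (ltn_ord r)).
Qed.

Lemma L_labelE r a :
  (L_label b (z r) == Some a) = same_part b (inl r) (inr (widen_ord jt a)).
Proof.
rewrite ffunE; case: pickP => [r' /eqP /z_inj ->|/(_ r)]; last by rewrite eqxx.
have [bot _ _ _] := in_LP jt _ bL.
case: pickP => [a' ra'|->] //; apply/eqP/idP => [[<-] //|ra].
congr Some; apply/eqP; rewrite -(inj_eq (@ord_inj _)) -!(Lcol_widen jt) -bot.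
by rewrite same_part_sym in ra'; apply: same_part_trans ra' ra.
Qed.

Lemma L_label_some r : exists a, L_label b (z r) = Some a.
Proof.
have [bot _ low _] := in_LP jt _ bL.
have [q rq] := low r; have [a _ qa] := insub_Lcol q (j_gt0 r).
exists a; apply/eqP; rewrite L_labelE.
by apply: same_part_trans rq _; rewrite bot qa Lcol_widen.
Qed.

Lemma L_label_onto : labeling_onto (L_label b).
Proof.
have [_ top _ _] := in_LP jt _ bL.
apply/forallP => a; have [r ra] := top (widen_ord jt a).
by apply/existsP; exists (z r); rewrite L_labelE.
Qed.

Lemma L_label_unlabelled : unlabelled (L_label b) = X.
Proof.
apply/setP => p; rewrite inE; case: (domP p) => [pX|[r ->]].
  by rewrite L_label_X // pX.
by have [a ->] := L_label_some r; rewrite (negPf (zX r)).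
Qed.

Lemma L_label_code x y :
  same_part b x y = (L_code (L_label b) x == L_code (L_label b) y).
Proof.
have [bot _ _ _] := in_LP jt _ bL.
have xE (x' : points t) : exists2 q,
    L_code (L_label b) x' = insub (Lcol j q) & same_part b x' (inr q).
  case: x' => [r|q]; last by exists q => //; apply: same_part_refl.
  have [a ra] := L_label_some r; exists (widen_ord jt a).
    by rewrite /= ra insub_Lcol_widen.
  by rewrite -L_labelE ra.
have [p -> xp] := xE x; have [q -> yq] := xE y.
rewrite (same_part_left _ xp) same_part_sym (same_part_left _ yq) bot.
by rewrite eq_sym Lcol_insub // (j_gt0 p).
Qed.

(** The parts of [d o b] are the fibres of [L_code c] precomposed with [tau] on
    the top row; those of [b.s] are the fibres of [L_code c] precomposed with
    the action of [s] on the bottom row, which is [s^-1] on the labels.  The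
    two maps differ by a permutation of the labels when [c] turns [sigma] into
    [s]. *)
Lemma L_code_fixed (s : 'S_j) (c : labeling m j) :
  same_part b =2 (fun x y => L_code c x == L_code c y) ->
  unlabelled c = X ->
  (dcomp d b == dperm (Lcol j) b s) = equivariant sigma s c.
Proof.
move=> bE cX.
have cmp x y : same_part (dcomp d b) x y =
    (L_code c (on_top tau x) == L_code c (on_top tau y)).
  rewrite -bE; apply: (same_part_dcomp_on_top dP) => [p|p z'];
    by rewrite in_setT.
have prm x y : same_part (dperm (Lcol j) b s) x y =
    (L_code c (on_bottom (bot_perm (Lcol j) s) x) ==
     L_code c (on_bottom (bot_perm (Lcol j) s) y)).
  by rewrite same_part_dperm bE.
have botE (q : 'I_t) : insub (Lcol j (bot_perm (Lcol j) s q)) =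
    omap (s^-1)%g (insub (Lcol j q)) :> option 'I_j.
  have [a -> qa] := insub_Lcol q (j_gt0 q).
  by rewrite (bot_perm_lt jt s qa) insub_Lcol_widen.
apply/eqP/equivariantP => [fixb p a|H].
  case: (domP p) => [pX|[r ->]].
    have : sigma p \in unlabelled c by rewrite cX sigmaX.
    have : p \in unlabelled c by rewrite cX.
    by rewrite !inE => /eqP -> /eqP ->.
  have := cmp (inl r) (inr (widen_ord jt a)); rewrite fixb prm /=.
  by rewrite botE insub_Lcol_widen /= tauE => <-.
apply: diagP => x y; rewrite cmp prm.
have omap_inj : injective (omap (s^-1)%g : option 'I_j -> option 'I_j).
  by move=> [a|] [a'|] //= [/perm_inj ->].
have codeE x' : L_code c (on_bottom (bot_perm (Lcol j) s) x') =
    omap (s^-1)%g (L_code c (on_top tau x')).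
  case: x' => [r|q] /=; last exact: botE.
  rewrite tauE.
  have /forallP/(_ (z r))/eqP -> : equivariant sigma s c by apply/equivariantP.
  by case: (c (z r)) => //= a; rewrite permK.
by rewrite !codeE (inj_eq omap_inj).
Qed.

End LabelOfDiagram.

Lemma L_code_in_L (c : labeling m j) :
  labeling_onto c -> unlabelled c = X -> in_L j (diag_of (L_code c)).
Proof.
move=> /forallP onto cX.
have cz r : exists a, c (z r) = Some a.
  case E: (c (z r)) => [a|]; first by exists a.
  by move: (zX r); rewrite -cX inE E.
have j0 (r : 'I_t) : (0 < j)%N.
  by have [a _] := cz r; apply: leq_ltn_trans (ltn_ord a).
apply/(in_LP jt); split.
- by move=> p q; rewrite same_part_diag_of /= -Lcol_insub ?j0.
- move=> q; have [a qa _] := insub_Lcol q (j0 q).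
  have /existsP[p /eqP pa] := onto a.
  case: (domP p) => [|[r pr]]; first by rewrite -cX inE pa.
  by exists r; rewrite same_part_diag_of /= qa -pr pa.
- move=> r; have [a ra] := cz r; exists (widen_ord jt a).
  by rewrite same_part_diag_of /= ra insub_Lcol_widen.
- by move=> t0; apply: (j0 (Ordinal t0)).
Qed.

Lemma L_codeK (c : labeling m j) :
  labeling_onto c -> unlabelled c = X -> L_label (diag_of (L_code c)) = c.
Proof.
move=> onto cX; have bL := L_code_in_L onto cX.
apply/ffunP => p; case: (domP p) => [pX|[r ->]].
  by rewrite L_label_X //; apply/eqP; rewrite eq_sym; move: pX; rewrite -cX inE.
case E: (c (z r)) => [a|]; last by move: (zX r); rewrite -cX inE E.
by apply/eqP; rewrite L_labelE // same_part_diag_of /= insub_Lcol_widen E.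
Qed.

(** [L_label] is injective on [L(t,j)], and [L_code] provides the preimages. *)
Lemma card_fixed_L (s : 'S_j) :
  #|[set b : Lti t j | dcomp d (val b) == val (L_ract b s)]| =
  #|[set c : labeling m j |
      [&& labeling_onto c, equivariant sigma s c & unlabelled c == X]]|.
Proof.
have label_inj : injective (fun b : Lti t j => L_label (val b)).
  move=> b b' bb; apply/val_inj/diagP => x y.
  by rewrite !L_label_code ?(valP b) ?(valP b') // bb.
rewrite -(card_imset _ label_inj); apply: eq_card => c; rewrite [RHS]inE.
have fixE (b : Lti t j) (e : diagram t) : e = dperm (Lcol j) (val b) s ->
    (dcomp d (val b) == e) = equivariant sigma s (L_label (val b)).
  move=> ->; apply: (L_code_fixed (valP b)).
    by move=> x y; apply: (L_label_code (valP b)).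
  exact: L_label_unlabelled (valP b).
apply/imsetP/and3P => [[b]|[onto eqv /eqP cX]].
  rewrite inE (fixE b _ (val_L_ract jt b s)) => fixb ->; split=> //.
    exact: L_label_onto (valP b).
  by rewrite (L_label_unlabelled (valP b)).
pose b : Lti t j := Sub (diag_of (L_code c)) (L_code_in_L onto cX).
exists b; last by rewrite /= L_codeK.
by rewrite inE (fixE b _ (val_L_ract jt b s)) /= L_codeK.
Qed.

End CountL.

Section CountV.
Variables (k m j : nat) (mk : (m <= k)%N) (jk : (j <= k)%N).
Variables (D : {set 'I_k}) (sigma : 'S_m) (pi : 'S_k) (d : diagram k).
Hypothesis DP : forall p : 'I_k, (p \in D) = (p < m)%N.
Hypothesis piE : forall p, pi (widen_ord mk p) = widen_ord mk (sigma p).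
Hypothesis pi_id : forall p, p \notin D -> pi p = p.
Hypothesis dP : pperm_diag D pi d.

Let w := widen_ord mk.
Let wj := widen_ord jk.

Let wj_inj : injective wj. Proof. by move=> p q [] /val_inj. Qed.

Let domP (p : 'I_k) : (exists p', p = w p') \/ p \notin D.
Proof.
rewrite DP; case: (ltnP p m) => [pm|]; last by right.
by left; exists (Ordinal pm); apply: val_inj.
Qed.

Let botP (q : 'I_k) : (exists a, q = wj a) \/ (j <= q)%N.
Proof.
case: (ltnP q j) => [qj|]; last by right.
by left; exists (Ordinal qj); apply: val_inj.
Qed.

(** The parts of a diagram of [V(k,j)] that isolates the points outside [D] are
    the fibres of [V_code c xi]; the three summands receive the labelled parts,
    the blocks of [xi] and the isolated points. *)
Definition V_code (c : labeling m j) (xi : {set {set 'I_m}}) (x : points k) :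
    'I_j + ({set 'I_m} + points k) :=
  match x with
  | inl p => if insub (val p) is Some p' then
               if c p' is Some a then inl a else inr (inl (pblock xi p'))
             else inr (inr (inl p))
  | inr q => if insub (val q) is Some a then inl a else inr (inr (inr q))
  end.
Arguments V_code : simpl never.

Let V_code_top c xi p : V_code c xi (inl (w p)) =
  if c p is Some a then inl a else inr (inl (pblock xi p)).
Proof. by rewrite /V_code /= valK. Qed.

Let V_code_iso c xi p : p \notin D -> V_code c xi (inl p) = inr (inr (inl p)).
Proof. by move=> pD; rewrite /V_code /= insubN // -DP. Qed.

Let V_code_lab c xi a : V_code c xi (inr (wj a)) = inl a.
Proof. by rewrite /V_code /= valK. Qed.

Let V_code_bot c xi (q : 'I_k) :
  (j <= q)%N -> V_code c xi (inr q) = inr (inr (inr q)).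
Proof. by move=> jq; rewrite /V_code /= insubN // -leqNgt. Qed.

Definition V_label (b : diagram k) : labeling m j :=
  [ffun p => [pick a | same_part b (inl (w p)) (inr (wj a))]].

Definition V_blocks (b : diagram k) : {set {set 'I_m}} :=
  preim_partition (fun p => pblock (dparts b) (inl (w p)))
    (unlabelled (V_label b)).

Let isolated_outside (b : diagram k) : Prop :=
  forall y x, y \notin D -> same_part b (inl y) x -> x = inl y.

Section LabelOfDiagram.
Variable b : diagram k.
Hypothesis bV : in_V j b.

Let sing p q : same_part b (inr p) (inr q) = (p == q).
Proof.
have [H _ _] := in_VP jk _ bV.
by apply/idP/eqP => [/H|->] //; apply: same_part_refl.
Qed.

Lemma V_labelE p a :
  (V_label b p == Some a) = same_part b (inl (w p)) (inr (wj a)).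
Proof.
rewrite ffunE; case: pickP => [a' pa'|->] //.
apply/eqP/idP => [[<-] //|pa]; congr Some; apply/wj_inj/eqP.
by rewrite -sing -(same_part_left _ pa').
Qed.

Lemma V_label_onto : isolated_outside b -> labeling_onto (V_label b).
Proof.
move=> iso; have [_ lab _] := in_VP jk _ bV.
apply/forallP => a; have [r ra] := lab a.
case: (domP r) => [[p rp]|/iso /(_ ra)] //.
by apply/existsP; exists p; rewrite V_labelE -rp.
Qed.

Lemma V_blocks_partition : partition (V_blocks b) (unlabelled (V_label b)).
Proof. exact: preim_partitionP. Qed.

Lemma V_label_code x y : isolated_outside b ->
  same_part b x y = (V_code (V_label b) (V_blocks b) x ==
                     V_code (V_label b) (V_blocks b) y).
Proof.
move=> iso; have [_ _ low] := in_VP jk _ bV.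
have isoE p z : p \notin D -> same_part b (inl p) z =
    (V_code (V_label b) (V_blocks b) (inl p) ==
     V_code (V_label b) (V_blocks b) z).
  move=> pD; rewrite V_code_iso //; apply/idP/eqP => [/(iso _ _ pD) ->|].
    by rewrite V_code_iso.
  case: z => q.
    case: (domP q) => [[q' ->]|qD].
      by rewrite V_code_top; case: (V_label b q').
    by rewrite V_code_iso // => -[->]; apply: same_part_refl.
  by case: (botP q) => [[a ->]|jq]; rewrite ?V_code_lab ?V_code_bot.
have topbot p q : same_part b (inl (w p)) (inr q) =
    (V_code (V_label b) (V_blocks b) (inl (w p)) ==
     V_code (V_label b) (V_blocks b) (inr q)).
  rewrite V_code_top.
  case: (botP q) => [[a ->]|jq].
    rewrite V_code_lab -V_labelE.
    by case: (V_label b p) => // a'; apply/eqP/eqP => [[->]|[->]].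
  rewrite V_code_bot //; transitivity false; last by case: (V_label b p).
  by apply/negP => /low; rewrite ltnNge jq.
case: x y => [p|p] [q|q].
- case: (domP p) => [[p' ->]|pD]; last exact: isoE.
  case: (domP q) => [[q' ->]|qD]; last by rewrite same_part_sym eq_sym isoE.
  rewrite !V_code_top.
  case Ep: (V_label b p') => [a|].
    have pa : same_part b (inl (w p')) (inr (wj a)) by rewrite -V_labelE Ep.
    rewrite (same_part_left _ pa) same_part_sym -V_labelE.
    by case: (V_label b q') => [a'|] //; apply/eqP/eqP => [[->]|[->]].
  case Eq: (V_label b q') => [a|].
    have qa : same_part b (inl (w q')) (inr (wj a)) by rewrite -V_labelE Eq.
    by rewrite same_part_sym (same_part_left _ qa) same_part_sym -V_labelE Ep.
  have pN : p' \in unlabelled (V_label b) by rewrite inE Ep.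
  have qN : q' \in unlabelled (V_label b) by rewrite inE Eq.
  rewrite -eq_pblock_dparts.
  transitivity (pblock (V_blocks b) p' == pblock (V_blocks b) q').
    rewrite -(mem_pblock_eq V_blocks_partition) //.
    rewrite pblock_equivalence_partition // => ? ? ? _ _ _.
    by split=> // /eqP ->.
  by apply/eqP/eqP => [->|[]].
- by case: (domP p) => [[p' ->]|pD]; [exact: topbot | exact: isoE].
- rewrite same_part_sym eq_sym.
  by case: (domP q) => [[q' ->]|qD]; [exact: topbot | exact: isoE].
- rewrite sing.
  case: (botP p) => [[a ->]|jp]; case: (botP q) => [[a' ->]|jq];
    rewrite ?V_code_lab ?V_code_bot //.
  + by apply/eqP => E; move: jq; rewrite -E leqNgt /= ltn_ord.
  + by apply/eqP => E; move: jp; rewrite E leqNgt /= ltn_ord.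
Qed.

(** The parts of [d o b] and of [b.s] are the fibres of [V_code c xi]
    precomposed with [pi] on the top row and with the action of [s] on the
    bottom row, respectively.  If [c] turns [sigma] into [s] and [sigma] fixes
    [xi], the two maps differ by [s] on the labels and [sigma] on the blocks.
    Conversely, the first condition is read on the pairs of a top point and a
    labelled bottom point, and the second on the pairs of unlabelled points. *)
Lemma V_code_fixed (s : 'S_j) (c : labeling m j) (xi : {set {set 'I_m}}) :
  isolated_outside b ->
  same_part b =2 (fun x y => V_code c xi x == V_code c xi y) ->
  partition xi (unlabelled c) ->
  (dcomp d b == dperm val b s) =
  equivariant sigma s c && ([set sigma @: (K : {set _}) | K in xi] == xi).
Proof.
move=> iso bE xiN.
have cmp x y : same_part (dcomp d b) x y =
    (V_code c xi (on_top pi x) == V_code c xi (on_top pi y)).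
  by rewrite -bE; apply: (same_part_dcomp_on_top dP pi_id).
have prm x y : same_part (dperm val b s) x y =
    (V_code c xi (on_bottom (bot_perm val s) x) ==
     V_code c xi (on_bottom (bot_perm val s) y)).
  by rewrite same_part_dperm bE.
have bot_lab a : bot_perm val s (wj a) = wj (s^-1%g a).
  exact: (bot_perm_lt jk s (erefl (val (wj a)))).
apply/eqP/andP => [fixb|[eqv /eqP fix_xi]].
  have eqv : equivariant sigma s c.
    apply/equivariantP => p a.
    have := cmp (inl (w p)) (inr (wj a)); rewrite fixb prm /= bot_lab piE.
    rewrite !V_code_top !V_code_lab.
    by case: (c p) (c (sigma p)) => [a1|] [a2|] /= E; rewrite // -?E;
      apply/eqP/eqP => [[->]|[->]].
  split=> //; apply/eqP/(fixed_partition xiN) => [p|p q pN qN].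
    exact: equivariant_unlabelled eqv.
  have := cmp (inl (w p)) (inl (w q)); rewrite fixb prm /= !piE.
  have spN := equivariant_unlabelled p eqv.
  have sqN := equivariant_unlabelled q eqv.
  rewrite pN in spN; rewrite qN in sqN.
  move: pN qN spN sqN; rewrite !inE => /eqP cp /eqP cq /eqP csp /eqP csq.
  by rewrite !V_code_top cp cq csp csq.
apply: diagP => x y; rewrite cmp prm.
pose f (v : 'I_j + ({set 'I_m} + points k)) : 'I_j + ({set 'I_m} + points k) :=
  match v with
  | inl a => inl (s a)
  | inr (inl K) => inr (inl (sigma @: K))
  | inr (inr x) => inr (inr x)
  end.
have f_inj : injective f.
  move=> [a|[K|x']] [a'|[K'|y']] //= []; first by move/perm_inj->.
  by move/(imset_inj (@perm_inj _ sigma)) ->.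
have codeE x' : V_code c xi (on_top pi x') =
    f (V_code c xi (on_bottom (bot_perm val s) x')).
  case: x' => [p|q] /=.
    case: (domP p) => [[p' ->]|pD]; last by rewrite pi_id // V_code_iso.
    rewrite piE !V_code_top.
    have /forallP/(_ p')/eqP -> := eqv.
    case E: (c p') => [a|] //=.
    by rewrite (pblock_fixed xiN fix_xi) // inE E.
  case: (botP q) => [[a ->]|jq].
    by rewrite bot_lab !V_code_lab /= permKV.
  by rewrite bot_perm_ge // !V_code_bot.
by rewrite !codeE (inj_eq f_inj).
Qed.

End LabelOfDiagram.

Lemma V_code_in_V c xi :
  labeling_onto c -> in_V j (diag_of (V_code c xi)).
Proof.
move=> /forallP onto; apply/(in_VP jk); split=> [p q|a|r q].
- rewrite same_part_diag_of.
  case: (botP p) => [[a ->]|jp]; case: (botP q) => [[a' ->]|jq];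
    rewrite ?V_code_lab ?V_code_bot //.
  + by move/eqP => [->].
  + by move/eqP => [].
- have /existsP[p /eqP pa] := onto a.
  by exists (w p); rewrite same_part_diag_of V_code_top pa V_code_lab.
- rewrite same_part_diag_of.
  case: (botP q) => [[a ->] _|jq]; first exact: (ltn_ord a).
  case: (domP r) => [[p ->]|rD]; last by rewrite V_code_iso ?V_code_bot.
  by rewrite V_code_top V_code_bot //; case: (c p).
Qed.

Lemma V_code_isolated c xi : isolated_outside (diag_of (V_code c xi)).
Proof.
move=> y x yD; rewrite same_part_diag_of V_code_iso //.
case: x => q; last first.
  by case: (botP q) => [[a ->]|jq]; rewrite ?V_code_lab ?V_code_bot.
case: (domP q) => [[p ->]|qD]; first by rewrite V_code_top; case: (c p).
by rewrite V_code_iso // => /eqP[->].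
Qed.

Lemma V_code_label c xi :
  labeling_onto c -> V_label (diag_of (V_code c xi)) = c.
Proof.
move=> onto; have bV := V_code_in_V xi onto.
have cE p a : (V_label (diag_of (V_code c xi)) p == Some a) = (c p == Some a).
  rewrite V_labelE // same_part_diag_of V_code_top V_code_lab.
  by case: (c p) => [a'|] //; apply/eqP/eqP => [[->]|[->]].
apply/ffunP => p; case E: (c p) => [a|]; first by apply/eqP; rewrite cE E.
case E': (V_label _ p) => [a|] //.
by have := cE p a; rewrite E E' eqxx.
Qed.

Lemma V_code_blocks c xi : labeling_onto c -> partition xi (unlabelled c) ->
  V_blocks (diag_of (V_code c xi)) = xi.
Proof.
move=> onto xiN; rewrite /V_blocks V_code_label //.
rewrite -[RHS](preim_partition_pblock xiN).
apply: eq_in_imset => p pN; apply/setP => q; rewrite !inE.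
apply: andb_id2l => qN; rewrite eq_pblock_dparts same_part_diag_of !V_code_top.
move: pN qN; rewrite !inE => /eqP -> /eqP ->.
by apply/eqP/eqP => [[]|->].
Qed.

(** [b |-> (V_label b, V_blocks b)] is injective on these diagrams, because they
    isolate the points outside [D]; [V_code] provides the preimages. *)
Lemma card_fixed_V (s : 'S_j) :
  #|[set b : Vki k j | dcomp d (val b) == val (V_ract b s)]| =
  #|[set cx : labeling m j * {set {set 'I_m}} |
      [&& labeling_onto cx.1, equivariant sigma s cx.1,
          partition cx.2 (unlabelled cx.1) &
          [set sigma @: (K : {set _}) | K in cx.2] == cx.2]]|.
Proof.
have iso (b : Vki k j) : dcomp d (val b) = val (V_ract b s) ->
    isolated_outside (val b).
  move=> fixb; apply: (fixed_isolated jk dP (s := s)); rewrite fixb.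
  exact: val_V_ract.
have fixE (b : Vki k j) (e : diagram k) : isolated_outside (val b) ->
    e = dperm val (val b) s ->
    (dcomp d (val b) == e) = equivariant sigma s (V_label (val b)) &&
      ([set sigma @: (K : {set _}) | K in V_blocks (val b)] ==
       V_blocks (val b)).
  move=> isob ->; apply: (V_code_fixed s isob).
    by move=> x y; apply: (V_label_code (valP b)).
  exact: V_blocks_partition.
have code_inj : {in [set b : Vki k j | dcomp d (val b) == val (V_ract b s)] &,
    injective (fun b : Vki k j => (V_label (val b), V_blocks (val b)))}.
  move=> b b'; rewrite !inE => /eqP /iso isob /eqP /iso isob' [lE bE].
  apply/val_inj/diagP => x y.
  apply: (etrans (V_label_code (valP b) x y isob)); rewrite lE bE.
  exact/esym/(V_label_code (valP b') x y isob').
rewrite -(card_in_imset code_inj); apply: eq_card => -[c xi].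
rewrite [RHS]inE /=.
apply/imsetP/and4P => [[b]|[onto eqv xiN fix_xi]].
  rewrite inE => fixb [-> ->]; have isob := iso b (eqP fixb).
  move: fixb; rewrite (fixE b _ isob (val_V_ract jk b s)) => /andP[eqv fix_xi].
  split=> //; [exact: V_label_onto (valP b) isob | exact: V_blocks_partition].
pose b : Vki k j := Sub (diag_of (V_code c xi)) (V_code_in_V xi onto).
exists b; last by rewrite /= V_code_label // V_code_blocks.
have isob : isolated_outside (val b) by apply: V_code_isolated.
rewrite inE (fixE b _ isob (val_V_ract jk b s)) /= V_code_label //.
by rewrite V_code_blocks // eqv.
Qed.

End CountV.

(** * The diagrams attached to an invariant set-partition *)

Lemma sum_delta (C : fieldType) (T : finType) (P : pred T) (c : C) (i : T) :
  \sum_(x | P x) c * (x == i)%:R = c * (P i)%:R.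
Proof.
rewrite -mulr_sumr; congr (_ * _).
rewrite big_mkcond (bigD1 i) //= eqxx big1 ?addr0 => [|x /negPf xi].
  by case: (P i).
by rewrite xi; case: (P x).
Qed.

Section CutDiagram.
Variables (k : nat) (mu : seq nat) (hm : (sumn mu <= k)%N).
Variables (X : {set 'I_(sumn mu)}) (xi : {set {set 'I_(sumn mu)}}).
Hypothesis xiX : xi \in SP X.

Local Notation m := (sumn mu).
Local Notation w := (widen_ord hm).
Local Notation D := (widen_set hm setT).
Local Notation Y := (~: widen_set hm setT).
Local Notation X' := (widen_set hm X).
Local Notation xi' := (widen_sets hm xi).
Local Notation Z := (Zset X' Y).
Local Notation d' := (d_mu_X hm X' xi').

Let xi_partition : partition xi X.
Proof. by move: xiX; rewrite inE => /andP[]. Qed.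

Let xi_fixed : [set sigma_mu mu @: (K : {set _}) | K in xi] = xi.
Proof. by move: xiX; rewrite inE => /andP[_ /eqP]. Qed.

Let mem_X p : (p \in X) = [exists K in xi, p \in K].
Proof.
rewrite -(cover_partition xi_partition).
by apply/bigcupP/exists_inP => -[K]; exists K.
Qed.

Lemma SP_invariant p : (sigma_mu mu p \in X) = (p \in X).
Proof.
rewrite !mem_X; apply/exists_inP/exists_inP => -[K Kxi pK]; last first.
  by exists (sigma_mu mu @: K); rewrite ?imset_f // -xi_fixed imset_f.
move: Kxi; rewrite -{1}xi_fixed => /imsetP[K' K'xi KE].
by exists K' => //; move: pK; rewrite KE (mem_imset _ _ (@perm_inj _ _)).
Qed.

Let memX' p : (w p \in X') = (p \in X).
Proof. exact: mem_widen_set. Qed.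

Let X'D p : p \in X' -> p \in D.
Proof. by move=> /imsetP[p' _ ->]; rewrite mem_widen_set inE. Qed.

Let mem_Z p : (p \in Z) = (p \in D) && (p \notin X').
Proof. by rewrite /Zset !inE negb_or negbK andbC. Qed.

Lemma sigma_ext_Z p : (sigma_ext hm p \in Z) = (p \in Z).
Proof.
rewrite !mem_Z sigma_ext_D; case: (boolP (p \in D)) => // /imsetP[p' _ ->].
by rewrite sigma_ext_widen !memX' SP_invariant.
Qed.

Definition point_index (x : points k) : 'I_k :=
  match x with inl p => p | inr p => p end.

Lemma same_part_d_mu_X x y :
  same_part d' x y =
  if point_index x \in X' then
    (point_index y \in X') &&
    (pblock xi' (point_index x) == pblock xi' (point_index y))
  else (point_index y \notin X') && same_part (d_mu hm) x y.
Proof.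
rewrite same_part_diag_of -(eq_pblock_dparts (d_mu hm)).
by case: x y => p [] q /=; case: ifP => pX; case: ifP => qX.
Qed.

Lemma card_Zset : #|Z| = #|~: X|.
Proof.
rewrite -(card_imset (mem (~: X)) (@widen_ord_injective _ _ hm)).
apply: eq_card => p; rewrite mem_Z; apply/andP/imsetP => [[]|[p' p'X ->]].
  by move=> /imsetP[p' _ ->]; rewrite memX' => p'X; exists p'; rewrite ?inE.
by rewrite mem_widen_set memX' !inE; split; rewrite // -in_setC.
Qed.

Let zlt (r : 'I_#|Z|) : (enum_val r < m)%N.
Proof. by have := enum_valP r; rewrite mem_Z widen_setT_ltn => /andP[]. Qed.

Definition Z_point (r : 'I_#|Z|) : 'I_m := Ordinal (zlt r).

Let wZ r : w (Z_point r) = enum_val r. Proof. exact: val_inj. Qed.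

Lemma Z_point_inj : injective Z_point.
Proof. by move=> r r' rr; apply: enum_val_inj; rewrite -!wZ rr. Qed.

Lemma Z_pointP p : reflect (exists r, Z_point r = p) (p \notin X).
Proof.
apply: (iffP idP) => [pX|[r <-]]; last first.
  by have := enum_valP r; rewrite -wZ mem_Z memX' => /andP[].
have pZ : w p \in Z by rewrite mem_Z memX' pX mem_widen_set inE.
exists (enum_rank_in pZ (w p)); apply: (@widen_ord_injective _ _ hm).
by rewrite wZ enum_rankK_in.
Qed.

(** The default value [r] is never taken, since [sigma_mu] preserves the
    complement of [X]. *)
Definition Z_perm_fun (r : 'I_#|Z|) : 'I_#|Z| :=
  odflt r [pick r' | Z_point r' == sigma_mu mu (Z_point r)].

Let Z_perm_funE r : Z_point (Z_perm_fun r) = sigma_mu mu (Z_point r).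
Proof.
rewrite /Z_perm_fun; case: pickP => [r' /eqP //|none].
have : sigma_mu mu (Z_point r) \notin X.
  by rewrite SP_invariant; apply/Z_pointP; exists r.
by case/Z_pointP => r' r'E; have := none r'; rewrite r'E eqxx.
Qed.

Let Z_perm_fun_inj : injective Z_perm_fun.
Proof.
move=> r r' rr; apply: Z_point_inj; apply: (@perm_inj _ (sigma_mu mu)).
by rewrite -!Z_perm_funE rr.
Qed.

Definition Z_perm : 'S_#|Z| := perm Z_perm_fun_inj.

Lemma Z_permE r : Z_point (Z_perm r) = sigma_mu mu (Z_point r).
Proof. by rewrite permE Z_perm_funE. Qed.

(** Away from [X] and [Y] nothing is left of [d_mu^{X,xi}] but the permutation
    induced by [sigma_mu]. *)
Lemma restrZ_pperm : pperm_diag setT Z_perm (restrZ X' Y d').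
Proof.
have [dl dr dm] := d_mu_pperm hm.
have Zn (r : 'I_#|Z|) : (enum_val r \in X') = false.
  by apply/negbTE; have := enum_valP r; rewrite mem_Z => /andP[].
split=> p q; rewrite same_part_drestr same_part_d_mu_X /= !Zn /=.
- by rewrite dl (inj_eq enum_val_inj).
- by rewrite dr (inj_eq enum_val_inj).
rewrite dm -!wZ mem_widen_set !inE /= sigma_ext_widen -Z_permE.
by rewrite (inj_eq (@widen_ord_injective _ _ hm)) (inj_eq Z_point_inj).
Qed.

Let xi'_partition : partition xi' X'.
Proof.
have /and3P[/eqP cov triv n0] := xi_partition.
apply/and3P; split.
- apply/eqP/setP => p.
  apply/bigcupP/imsetP => [[_ /imsetP[K Kxi ->]]|[q qX ->]].
    case/imsetP => q qK ->; exists q => //.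
    by rewrite mem_X; apply/exists_inP; exists K.
  move: qX; rewrite mem_X => /exists_inP[K Kxi qK].
  by exists (widen_set hm K); rewrite ?imset_f ?mem_widen_set.
- apply/trivIsetP => _ _ /imsetP[K Kxi ->] /imsetP[L Lxi ->] KL.
  have KL' : K != L by apply: contraNneq KL => ->.
  rewrite -setI_eq0; apply/eqP/setP => p; rewrite !inE; apply/negP.
  case/andP => /imsetP[q qK ->]; rewrite mem_widen_set => qL.
  have /trivIsetP/(_ K L Kxi Lxi KL')/pred0P/(_ q) := triv.
  by rewrite /= qK qL.
apply/negP => /imsetP[K Kxi /esym/eqP]; rewrite imset_eq0 => /eqP K0.
by move: n0; rewrite -K0 Kxi.
Qed.

Lemma d_mu_X_Iset : d' \in Iset X' Y xi'.
Proof.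
have [dl dr dm] := d_mu_pperm hm.
rewrite inE; apply/and3P; split.
- apply/forall_inP => A Axi.
  have /and3P[/eqP cov triv n0] := xi'_partition.
  have /set0Pn[p pA] : A != set0 by apply: contraNneq n0 => <-.
  have pX : p \in X' by rewrite -cov; apply/bigcupP; exists A.
  suff -> : doubled A = pblock (dparts d') (inl p) by apply: pblock_dparts_mem.
  have dE x : (x \in doubled A) = (point_index x \in A).
    rewrite inE; case: x => q /=; apply/orP/idP => [[]|qA].
    + by case/imsetP => ? ? [->].
    + by case/imsetP.
    + by left; apply: imset_f.
    + by case/imsetP.
    + by case/imsetP => ? ? [->].
    + by right; apply: imset_f.
  apply/setP => x; rewrite dE -/(same_part d' (inl p) x) same_part_d_mu_X /= pX.
  have AE := def_pblock triv Axi pA; rewrite AE.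
  apply/idP/andP => [xA|[xX /eqP ->]]; last by rewrite mem_pblock cov.
  split; first by rewrite -cov; apply/bigcupP; exists A.
  by rewrite (def_pblock triv Axi xA).
- apply/forall_inP => y; rewrite inE => yD.
  have yX : (y \in X') = false by apply/negP => /X'D; apply/negP.
  have single x :
      (forall z, same_part d' x z = (x == z)) -> [set x] \in dparts d'.
    move=> xE; suff -> : [set x] = pblock (dparts d') x.
      exact: pblock_dparts_mem.
    by apply/setP => z; rewrite inE eq_sym -xE.
  apply/andP; split; apply: single => -[] z; rewrite same_part_d_mu_X /= yX.
  + rewrite dl; apply: andb_idl => /eqP[<-]; by rewrite yX.
  + by rewrite dm (negPf yD) andbF.
  + rewrite same_part_sym dm; apply/negP => /and3P[_ zD /eqP yz].
    by move: yD; rewrite yz sigma_ext_D zD.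
  + rewrite dr; apply: andb_idl => /eqP[<-]; by rewrite yX.
apply/forall_inP => B /dparts_pblock[x xB BE]; apply/implyP => /subsetP BZ.
have xZ : point_index x \in Z.
  have := BZ x xB; rewrite inE => /orP[] /imsetP[p pZ ->] //.
have /andP[xD xX] : (point_index x \in D) && (point_index x \notin X').
  by rewrite -mem_Z.
rewrite BE; apply/propagating_pblockP.
case: x xZ xD xX {xB BE} => p /= pZ pD pX.
  split; first by exists p; apply: same_part_refl.
  exists (sigma_ext hm p); rewrite same_part_d_mu_X /= (negPf pX) dm pD eqxx.
  by move: pZ; rewrite -sigma_ext_Z mem_Z => /andP[_ ->].
split; last by exists p; apply: same_part_refl.
exists ((sigma_ext hm)^-1%g p).
rewrite same_part_d_mu_X /= (negPf pX) same_part_sym dm permKV eqxx.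
move: pZ; rewrite -{1}[p](permKV (sigma_ext hm)) sigma_ext_Z mem_Z.
by case/andP=> -> ->.
Qed.

Lemma Iiso_d_mu_X (C : fieldType) (delta : C) e :
  Iiso delta X' Y xi' (dbasis C d') e =
  delta ^+ #|Y| * (restrZ X' Y d' == val e)%:R.
Proof.
rewrite ffunE.
have dE d : dbasis C d' d = (d == d')%:R by rewrite ffunE.
under eq_bigr do rewrite dE.
rewrite (sum_delta (fun d =>
  (d \in Iset X' Y xi') && (restrZ X' Y d == val e))).
by rewrite d_mu_X_Iset.
Qed.

End CutDiagram.

(** A pair [(c, xi)] is sorted by the set [X] left unlabelled by [c]. *)
Lemma sum_fixed_labelings (mu : seq nat) (j : nat) (s : 'S_j) :
  #|[set cx : labeling (sumn mu) j * {set {set 'I_(sumn mu)}} |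
      [&& labeling_onto cx.1, equivariant (sigma_mu mu) s cx.1,
          partition cx.2 (unlabelled cx.1) &
          [set sigma_mu mu @: (K : {set _}) | K in cx.2] == cx.2]]| =
  (\sum_(X : {set 'I_(sumn mu)}) \sum_(xi in SP X)
    #|[set c : labeling (sumn mu) j |
        [&& labeling_onto c, equivariant (sigma_mu mu) s c &
            unlabelled c == X]]|)%N.
Proof.
pose P (c : labeling (sumn mu) j) :=
  labeling_onto c && equivariant (sigma_mu mu) s c.
transitivity (\sum_(c | P c) #|SP (unlabelled c)|)%N.
  rewrite -sum1_card; under [RHS]eq_bigr do rewrite -sum1_card.
  rewrite pair_big_dep /=; apply: eq_bigl => -[c xi].
  by rewrite !inE /= /P -andbA.
rewrite (partition_big (@unlabelled _ _) predT) //=; apply: eq_bigr => X _.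
rewrite (eq_bigr (fun=> #|SP X|)) => [|c /andP[_ /eqP ->] //].
rewrite sum_nat_cond_const sum_nat_const mulnC; congr (_ * _)%N.
by apply: eq_card => c; rewrite !inE andbA.
Qed.

(** * The character formula *)

(** For [j > t] the set of labelings is empty, since their [j] labels are taken
    on the [t] points outside [X]. *)
Lemma chi_I_d_mu_X (C : fieldType) (delta : C) (k j : nat) (mu la : seq nat)
    (hm : (sumn mu <= k)%N) (X : {set 'I_(sumn mu)}) xi :
  j`!%:R != 0 :> C -> xi \in SP X ->
  let Y := ~: widen_set hm setT in
  let X' := widen_set hm X in
  let xi' := widen_sets hm xi in
  chi_I delta X' Y xi' j la (dbasis C (d_mu_X hm X' xi')) =
  j`!%:R^-1 * \sum_(s : 'S_j) vtrace (@specht_act C j la s) *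
    (delta ^+ #|Y| *
     #|[set c : labeling (sumn mu) j |
         [&& labeling_onto c, equivariant (sigma_mu mu) s c &
             unlabelled c == X]]|%:R).
Proof.
move=> fact_neq0 xiX Y X' xi'; rewrite /chi_I.
case: ltnP => [tj|jt].
  rewrite big1 ?mulr0 // => s _.
  rewrite (_ : [set c | _] = set0) ?cards0 ?mulr0 //.
  apply/setP => c; rewrite !inE; apply/negP => /and3P[onto _ /eqP cX].
  by move: tj; rewrite ltnNge card_Zset -cX card_labelled.
rewrite (chi_Istar_pperm la fact_neq0 jt (restrZ_pperm hm xiX)
  (Iiso_d_mu_X xiX delta)).
congr (_ * _); apply: eq_bigr => s _; congr (_ * (_ * _%:R)).
exact: (card_fixed_L (@Z_point_inj _ _ hm X) (Z_pointP hm X)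
  (SP_invariant xiX) (Z_permE xiX) (restrZ_pperm hm xiX) jt).
Qed.

Unset Implicit Arguments.

Theorem theorem4p9 (R : realType) (k : nat) (delta : R[i]) (mu : seq nat)
    (j : nat) (la : seq nat)
    (hk : (1 <= k)%N) (hdelta : delta != 0)
    (hmu : is_composition mu (sumn mu)) (hm : (sumn mu <= k)%N)
    (hla : is_partition la j) (hj : (j <= sumn mu)%N) :
  let Y : {set 'I_k} := ~: widen_set hm [set: 'I_(sumn mu)] in
  chi_P j delta la (dbasis R[i] (d_mu hm)) =
  \sum_(X : {set 'I_(sumn mu)}) \sum_(xi in SP X)
    chi_I delta (widen_set hm X) Y (widen_sets hm xi) j la
      (dbasis R[i] (d_mu_X hm (widen_set hm X) (widen_sets hm xi))).
Proof.
move=> Y.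
have fact_neq0 : j`!%:R != 0 :> R[i].
  by rewrite Num.Theory.pnatr_eq0 -lt0n fact_gt0.
have jk := leq_trans hj hm.
rewrite (chi_P_pperm delta la fact_neq0 jk (d_mu_pperm hm)
  (sigma_ext_D hm)).
under eq_bigr => s _.
  rewrite (card_fixed_V jk (widen_setT_ltn hm) (sigma_ext_widen hm)
    (@sigma_ext_id _ _ hm) (d_mu_pperm hm) s).
  rewrite sum_fixed_labelings natr_sum.
  under [X in _ * (_ * X)]eq_bigr do rewrite natr_sum.
  rewrite !mulr_sumr.
  under eq_bigr do rewrite !mulr_sumr.
  over.
rewrite exchange_big mulr_sumr; apply: eq_bigr => X _.
rewrite exchange_big mulr_sumr; apply: eq_bigr => xi xiX.
by rewrite (chi_I_d_mu_X delta la hm fact_neq0 xiX).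
Qed.
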